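(* For each integer $\ell \geq 1$, as $x \to \infty$, $$\#\big\{ p \leq x : \phi(p-\ell) = \phi(p+\ell) \big\} \ll \begin{cases} \dfrac{x}{(\log x)^3} & \text{if } \ell = 4^n - 1 \text{ for some integer } n \geq 1,\\[10pt] \dfrac{x}{e^{(\log x)^{1/3}}} & \text{otherwise,}\end{cases}$$ where $p$ ranges over odd primes with $p > \ell$ and the implied constant may depend on $\ell$.
   Context: $\phi$ is the Euler totient function. The letter $p$ always denotes an odd prime. The notation $f(x) \ll g(x)$ means that there is a constant $C>0$ such that $|f(x)| \leq C g(x)$ for all sufficiently large $x$. *)

(* Defs.v *)
From HB Require Import structures.
From mathcomp Require Import all_boot all_order all_algebra.
From mathcomp Require Import all_classical all_reals all_analysis.
Set Implicit Arguments.
Unset Strict Implicit.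
Unset Printing Implicit Defensive.
Import Order.TTheory GRing.Theory Num.Theory.
Import numFieldNormedType.Exports.
Local Open Scope classical_set_scope.
Local Open Scope ring_scope.

Definition vinogradov (R : realType) (f g : R -> R) : Prop :=
  exists2 C : R, 0 < C & \forall x \near +oo, `|f x| <= C * g x.

Notation "f ≪ g" := (vinogradov f g) (at level 70, no associativity) : ring_scope.

(* For x >= 0, p <= Num.truncn x iff p%:R <= x; for x < 0 the count is 0, as it
   should be. The condition l < p keeps the subtraction p - l from truncating. *)
Definition totient_count (R : realType) (l : nat) (x : R) : nat :=
  #|[pred p : 'I_(Num.truncn x).+1 |
      [&& prime p, odd p, (l < p)%N & totient (p - l) == totient (p + l)]]|.

Definition pow4_pred (l : nat) : Prop :=
  exists2 n : nat, (1 <= n)%N & l = (4 ^ n - 1)%N.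

(* Main.v *)
(* The solutions are handled as by Graham, Holt and Pomerance. Put n = p - l, n' = p + l and
   t = (log x)^(1/3), so that the target is x exp(-t). Up to O(x exp(-2t)) times lower-order
   factors one may assume that n has a prime factor q > exp(2t^2) (smooth numbers, by Rankin's
   trick), that q - 1 has a prime factor r > exp(4t) (again Rankin), and that no large square
   divides n n'. As r divides phi(n) = phi(n'), some prime q' = 1 mod r divides n'. If
   q q' <= x exp(2t), count the pairs q, q' in the class 1 mod r. Otherwise write n = m q and
   n' = m' q': there are few pairs (m, m'), and each determines n through the linear system
   m q + 2l = m' q', phi(m)(q - 1) = phi(m')(q' - 1), unless m phi(m') = m' phi(m). In that
   degenerate case m' = m + 2l and m, m' have the same prime factors; as p is prime they are
   powers of 2, so that m = 2, M = l + 1 is a power of 2, and with u = q' - 1 the numbers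
   u + 1, M u + 1 and p = 2 (M u + 1) + l are all prime. If M is not a power of 4, one of them
   is divisible by 3; otherwise Selberg's sieve gives O(x / (log x)^3). *)

Require Import Defs.
From HB Require Import structures.
From mathcomp Require Import all_boot all_order all_algebra.
From mathcomp Require Import all_classical all_reals all_analysis.
From mathcomp Require Import ring lra zify.
Import Order.TTheory GRing.Theory Num.Theory.
Import numFieldNormedType.Exports.
Local Open Scope classical_set_scope.
Local Open Scope ring_scope.

(** * Sums over smooth numbers *)

(** The exponent 1/3 comes from balancing three losses. For cutoffs exp Y on [q] and exp Z on [r],
    Rankin's trick saves exp(4 log x / Y) when [n] is smooth and exp(4 Y / Z) when [q - 1] is
    smooth, while sums over moduli beyond exp Z save at most exp Z. Equal orders force Z, Y and log
    x to be of order t, t^2 and t^3. The constants make every class at most x exp(-2t) times factors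
    that a single exp t absorbs, among them the Euler product over p <= exp Y: a crude bound O(log
    Y) for the sum of 1/p makes it a power of t. The sieve has dimension 3 and needs a lower bound
    of order (log x)^3 for a sum over squarefree integers. No asymptotics over primes enter: that
    sum dominates a threefold convolution of 1/n over smooth integers, which contains the cube of a
    harmonic sum. *)

(* As [primes 0] is empty, [smooth s 0] holds; sums over smooth numbers start at 1. *)
Definition smooth (s : seq nat) (n : nat) : bool := all (mem s) (primes n).

Lemma smooth_cons_dvd (p : nat) (s : seq nat) (n : nat) :
  smooth (p :: s) n -> smooth s n || (p %| n)%N.
Proof.
move=> /allP sm; case: (boolP (p %| n)%N) => [|ndiv]; first by rewrite orbT.
rewrite orbF; apply/allP => q qn; have := sm q qn; rewrite /= inE.
case: eqP => [qp|//]; move: qn; rewrite mem_primes qp => /and3P[_ _ pn].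
by rewrite pn in ndiv.
Qed.

Lemma smooth_cons_mull (p : nat) (s : seq nat) (n : nat) : (0 < n)%N -> prime p ->
  smooth (p :: s) (p * n) = smooth (p :: s) n.
Proof.
move=> n0 pp; apply/allP/allP => sm q qn.
  by apply: sm; move: qn; rewrite !mem_primes muln_gt0 n0 (prime_gt0 pp) => /and3P[-> _ qn]; rewrite dvdn_mull.
move: (qn); rewrite mem_primes => /and3P[qp _]; rewrite Euclid_dvdM// => /orP[qdp|qdn].
  by move: qdp; rewrite dvdn_prime2//= inE => ->.
by apply: sm; rewrite mem_primes qp n0.
Qed.

Lemma smooth_nil (n : nat) : (0 < n)%N -> smooth [::] n = (n == 1%N).
Proof.
move=> n0; apply/idP/eqP => [|->//]; rewrite /smooth => /allP sm.
case: (ltngtP n 1%N) => // [|n1]; first by rewrite ltnS leqn0 => /eqP n00; rewrite n00 in n0.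
by have := sm (pdiv n); rewrite mem_primes pdiv_prime// pdiv_dvd n0 => /(_ isT).
Qed.

Lemma sum_multiples (R : nmodType) (f : nat -> R) (d N : nat) : (0 < d)%N ->
  \sum_(1 <= n < N.+1 | (d %| n)%N) f n = \sum_(1 <= m < (N %/ d).+1) f (d * m)%N.
Proof.
move=> d0; elim: N => [|N IH]; first by rewrite div0n !big_geq.
rewrite big_mkcond big_nat_recr//= -big_mkcond /= IH divnS//.
case: (boolP (d %| N.+1)%N) => dN; last by rewrite add0n addr0.
rewrite add1n [RHS]big_nat_recr//=; congr (_ + f _).
by rewrite -[LHS](divnK dN) divnS// dN add1n mulnC.
Qed.

Lemma sum_smooth_cons (R : realFieldType) (w : nat -> R) (p : nat) (s : seq nat) (N : nat) :
  prime p -> (forall n, (0 < n)%N -> 0 <= w n) ->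
  \sum_(1 <= n < N.+1 | smooth (p :: s) n) w n <=
  \sum_(1 <= n < N.+1 | smooth s n) w n +
  \sum_(1 <= n < (N %/ p).+1 | smooth (p :: s) n) w (p * n)%N.
Proof.
move=> pp w0; have p0 := prime_gt0 pp.
have -> : \sum_(1 <= n < (N %/ p).+1 | smooth (p :: s) n) w (p * n)%N =
          \sum_(1 <= n < N.+1 | (p %| n)%N) (if smooth (p :: s) n then w n else 0).
  rewrite sum_multiples// big_mkcond; apply: eq_big_nat => n /andP[n0 _].
  by rewrite smooth_cons_mull.
rewrite [X in X <= _]big_mkcond [X in _ <= X + _]big_mkcond [X in _ <= _ + X]big_mkcond.
rewrite -big_split /= big_seq_cond [leRHS]big_seq_cond; apply: ler_sum => n.
rewrite mem_index_iota andbT => /andP[n0 _].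
case: ifP => sm; last by case: ifP => _; case: ifP => _; rewrite ?addr0 ?add0r ?w0.
by have := smooth_cons_dvd _ _ _ sm; case: (smooth s n); case: (p %| n)%N => //= _;
   rewrite ?addr0 ?add0r // lerDl w0.
Qed.

Definition smooth_sum {R : realFieldType} (g : nat -> R) (s : seq nat) (N : nat) : R :=
  \sum_(1 <= n < N.+1 | smooth s n) g n.

Lemma smooth_sum_ge0 (R : realFieldType) (g : nat -> R) (s : seq nat) (N : nat) :
  (forall n, (0 < n)%N -> 0 <= g n) -> 0 <= smooth_sum g s N.
Proof.
move=> g0; rewrite /smooth_sum big_seq_cond; apply: sumr_ge0 => n.
by rewrite mem_index_iota => /andP[/andP[n0 _] _]; apply: g0.
Qed.

Lemma sum_nat_widen_le (R : realFieldType) (P : pred nat) (f : nat -> R) (m N N' : nat) :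
  (N <= N')%N -> (forall n, (m <= n)%N -> 0 <= f n) ->
  \sum_(m <= n < N | P n) f n <= \sum_(m <= n < N' | P n) f n.
Proof.
move=> NN f0; case: (leqP m N) => mN; last first.
  rewrite big_geq 1?ltnW// big_seq_cond; apply: sumr_ge0 => n.
  by rewrite mem_index_iota => /andP[/andP[n0 _] _]; apply: f0.
rewrite (big_cat_nat mN NN) //= lerDl big_seq_cond; apply: sumr_ge0 => n.
rewrite mem_index_iota => /andP[/andP[n0 _] _]; apply: f0; exact: leq_trans n0.
Qed.

Lemma smooth_sum_mono (R : realFieldType) (g : nat -> R) (s : seq nat) (N N' : nat) :
  (N <= N')%N -> (forall n, (0 < n)%N -> 0 <= g n) -> smooth_sum g s N <= smooth_sum g s N'.
Proof. by move=> NN g0; apply: sum_nat_widen_le. Qed.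

Lemma smooth_sum_cons (R : realFieldType) (g : nat -> R) (p : nat) (s : seq nat) (N : nat) :
  (forall n, (0 < n)%N -> 0 <= g n) ->
  (forall m n, (0 < m)%N -> (0 < n)%N -> g (m * n)%N = g m * g n) ->
  prime p -> g p < 1 ->
  smooth_sum g (p :: s) N <= (1 - g p)^-1 * smooth_sum g s N.
Proof.
move=> g0 gM pp gp1; have p0 := prime_gt0 pp; have gp0 := g0 p p0.
rewrite ler_pdivlMl ?subr_gt0// mulrBl mul1r lerBlDr.
apply: le_trans (sum_smooth_cons _ _ _ _ _ pp g0) _; rewrite lerD2l.
have -> : \sum_(1 <= n < (N %/ p).+1 | smooth (p :: s) n) g (p * n)%N =
          g p * smooth_sum g (p :: s) (N %/ p).
  rewrite /smooth_sum big_distrr/= big_seq_cond [RHS]big_seq_cond; apply: eq_bigr => n.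
  by rewrite mem_index_iota => /andP[/andP[n0 _] _]; apply: gM.
by apply: ler_wpM2l => //; apply: smooth_sum_mono => //; apply: leq_div.
Qed.

(* A partial Euler product without infinite sums: a number whose primes lie in [p :: s] either
   has them in [s] or is [p] times a smaller such number. *)
Lemma smooth_sum_cat (R : realFieldType) (g : nat -> R) (r s : seq nat) (N : nat) :
  (forall n, (0 < n)%N -> 0 <= g n) ->
  (forall m n, (0 < m)%N -> (0 < n)%N -> g (m * n)%N = g m * g n) ->
  (forall p, p \in r -> prime p /\ g p < 1) ->
  smooth_sum g (r ++ s) N <= \prod_(p <- r) (1 - g p)^-1 * smooth_sum g s N.
Proof.
move=> g0 gM; elim: r => [|p r IH] hr; first by rewrite big_nil mul1r.
have [pp gp] := hr p (mem_head _ _).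
rewrite cat_cons big_cons; apply: le_trans (smooth_sum_cons _ _ _ _ _ g0 gM pp gp) _.
rewrite -mulrA ler_pM2l ?invr_gt0 ?subr_gt0//.
by apply: IH => q qr; apply: hr; rewrite inE qr orbT.
Qed.

Lemma smooth_sum_nil_le (R : realFieldType) (g : nat -> R) (N : nat) :
  0 <= g 1%N -> smooth_sum g [::] N <= g 1%N.
Proof.
move=> g1; rewrite /smooth_sum; case: N => [|N]; first by rewrite big_geq.
rewrite big_ltn_cond//= big_nat_cond big1 ?addr0// => n /andP[/andP[n1 _]].
by rewrite smooth_nil 1?ltnW// => /eqP n1'; rewrite n1' in n1.
Qed.

Lemma smooth_sum_prod (R : realFieldType) (g : nat -> R) (r : seq nat) (N : nat) :
  (forall n, (0 < n)%N -> 0 <= g n) -> g 1%N = 1 ->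
  (forall m n, (0 < m)%N -> (0 < n)%N -> g (m * n)%N = g m * g n) ->
  (forall p, p \in r -> prime p /\ g p < 1) ->
  smooth_sum g r N <= \prod_(p <- r) (1 - g p)^-1.
Proof.
move=> g0 g1 gM hr; rewrite -[r in X in X <= _]cats0.
apply: le_trans (smooth_sum_cat _ _ _ _ _ g0 gM hr) _.
rewrite -[leRHS]mulr1; apply: ler_wpM2l; last by rewrite -[leRHS]g1 smooth_sum_nil_le ?g0.
rewrite big_seq; apply: prodr_ge0 => p /hr[pp gp].
by rewrite invr_ge0 subr_ge0 ltW.
Qed.

(* The sum of 1/(a_1 ... a_k) over s-smooth a_i with a_1 ... a_k <= N. *)
Fixpoint smooth_conv {R : realFieldType} (s : seq nat) (k N : nat) : R :=
  if k is k'.+1 then \sum_(1 <= a < N.+1 | smooth s a) a%:R^-1 * smooth_conv s k' (N %/ a)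
  else (0 < N)%:R.

Lemma smooth_conv_ge0 (R : realFieldType) (s : seq nat) (k N : nat) : 0 <= smooth_conv s k N :> R.
Proof.
elim: k N => [|k IH] N /=; first exact: ler0n.
by apply: sumr_ge0 => a _; rewrite mulr_ge0 ?invr_ge0 ?ler0n.
Qed.

Lemma smooth_conv_mono (R : realFieldType) (s : seq nat) (k N N' : nat) : (N <= N')%N ->
  smooth_conv s k N <= smooth_conv s k N' :> R.
Proof.
elim: k N N' => [|k IH] N N' NN /=.
  by rewrite ler_nat; case: N NN => // N NN; rewrite (leq_ltn_trans (leq0n N) NN).
apply: le_trans (_ : _ <= \sum_(1 <= a < N.+1 | smooth s a) a%:R^-1 * smooth_conv s k (N' %/ a)) _.
  by apply: ler_sum => a _; rewrite ler_wpM2l ?invr_ge0 ?ler0n// IH// leq_div2r.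
by apply: sum_nat_widen_le => // a a0; rewrite mulr_ge0 ?invr_ge0 ?ler0n ?smooth_conv_ge0.
Qed.

(** Either [p] divides no entry of the tuple, or one of the [k] entries can be divided by [p], which
    costs a factor 1/p and replaces [N] by [N / p]. The induction on [k] treats the first entry and
    then the others. *)
Lemma smooth_conv_cons (R : realFieldType) (p : nat) (s : seq nat) (k N : nat) : prime p ->
  smooth_conv (p :: s) k N <= smooth_conv s k N + k%:R / p%:R * smooth_conv (p :: s) k (N %/ p) :> R.
Proof.
move=> pp; have p0 := prime_gt0 pp; elim: k N => [|k IH] N; first by rewrite /= !mul0r addr0.
rewrite [smooth_conv (p :: s) k.+1 N]/=.
apply: le_trans (sum_smooth_cons _ (fun a => a%:R^-1 * smooth_conv (p :: s) k (N %/ a)) _ _ _ pp _) _.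
  by move=> n n0; rewrite mulr_ge0 ?invr_ge0 ?ler0n ?smooth_conv_ge0.
have E : \sum_(1 <= n < (N %/ p).+1 | smooth (p :: s) n)
     ((p * n)%N%:R^-1 * smooth_conv (p :: s) k (N %/ (p * n))) =
     p%:R^-1 * smooth_conv (p :: s) k.+1 (N %/ p) :> R.
  by rewrite /= big_distrr/=; apply: eq_bigr => n _; rewrite natrM invfM divnMA mulrA.
rewrite E -natr1 [(k%:R + 1) / _]mulrDl mul1r mulrDl addrA lerD2r.
apply: le_trans (_ : _ <= \sum_(1 <= a < N.+1 | smooth s a)
   (a%:R^-1 * smooth_conv s k (N %/ a) + k%:R / p%:R * (a%:R^-1 * smooth_conv (p :: s) k (N %/ p %/ a)))) _.
  apply: ler_sum => a _; rewrite mulrCA -mulrDr ler_wpM2l ?invr_ge0 ?ler0n//.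
  by rewrite -divnMA mulnC divnMA.
rewrite big_split /= lerD2l -big_distrr/= ler_wpM2l ?mulr_ge0 ?invr_ge0 ?ler0n//.
have sub a : smooth s a -> smooth (p :: s) a.
  by move=> /allP h; apply/allP => q /h /= qs; rewrite inE qs orbT.
have t0 a : 0 <= a%:R^-1 * smooth_conv (p :: s) k (N %/ p %/ a) :> R.
  by rewrite mulr_ge0 ?invr_ge0 ?ler0n ?smooth_conv_ge0.
apply: le_trans (_ : _ <= \sum_(1 <= a < N.+1 | smooth (p :: s) a)
   (a%:R^-1 * smooth_conv (p :: s) k (N %/ p %/ a))) _.
  rewrite big_mkcond [leRHS]big_mkcond; apply: ler_sum => a _.
  by case: ifP => [/sub ->//|_]; case: ifP.
rewrite (@big_cat_nat _ _ _ (N %/ p).+1) //=; last by rewrite ltnS leq_div.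
rewrite -[leRHS]addr0 lerD2l big_seq_cond big1// => a; rewrite mem_index_iota => /andP[/andP[h _] _].
rewrite divn_small//; suff -> : smooth_conv (p :: s) k 0 = 0 :> R by rewrite mulr0.
by case: (k) => //= k'; rewrite big_geq.
Qed.

(* The sum over squarefree d <= N with prime factors in s of the product of the h p, p | d. *)
Fixpoint sqfree_sum {R : realFieldType} (h : nat -> R) (s : seq nat) (N : nat) : R :=
  if s is p :: s' then sqfree_sum h s' N + h p * sqfree_sum h s' (N %/ p) else (0 < N)%:R.

Lemma sqfree_sum_mono (R : realFieldType) (h : nat -> R) (s : seq nat) (N N' : nat) :
  (forall p, p \in s -> 0 <= h p) -> (N <= N')%N -> sqfree_sum h s N <= sqfree_sum h s N'.
Proof.
elim: s N N' => [|p s IH] N N' hs NN /=.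
  by rewrite ler_nat; case: N NN => // N NN; rewrite (leq_ltn_trans (leq0n N) NN).
have hs' q : q \in s -> 0 <= h q by move=> qs; apply: hs; rewrite inE qs orbT.
by apply: lerD; rewrite ?IH// ler_wpM2l ?hs ?mem_head// IH// leq_div2r.
Qed.

Lemma smooth_conv_nil_le (R : realFieldType) (k N : nat) : smooth_conv [::] k N <= (0 < N)%:R :> R.
Proof.
elim: k N => [|k IH] N //=; case: N => [|N]; first by rewrite big_geq.
rewrite big_ltn_cond//= big_nat_cond big1 ?addr0.
  by rewrite invr1 mul1r divn1; apply: IH.
move=> n /andP[/andP[n1 _]].
by rewrite smooth_nil 1?ltnW// => /eqP n1'; rewrite n1' in n1.
Qed.

Lemma sqfree_sum0 (R : realFieldType) (h : nat -> R) (s : seq nat) : sqfree_sum h s 0 = 0.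
Proof. by elim: s => //= p s IH; rewrite div0n IH mulr0 addr0. Qed.

Lemma smooth_conv0 (R : realFieldType) (s : seq nat) (k : nat) : smooth_conv s k 0 = 0 :> R.
Proof. by case: k => //= k'; rewrite big_geq. Qed.

(* Both sides obey a recursion on [s], with f = k/p against h = f/(1 - f), so that f (1 + h) = h. *)
Lemma smooth_conv_le_sqfree_sum (R : realFieldType) (h : nat -> R) (k : nat) (s : seq nat) (N : nat) :
  (forall p, p \in s -> [/\ prime p, (k < p)%N & h p = k%:R / (p%:R - k%:R)]) ->
  smooth_conv s k N <= sqfree_sum h s N.
Proof.
elim: s N => [|p s IH] N hs; first exact: smooth_conv_nil_le.
have [pp kp hp] := hs p (mem_head _ _).
have hs' q : q \in s -> [/\ prime q, (k < q)%N & h q = k%:R / (q%:R - k%:R)].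
  by move=> qs; apply: hs; rewrite inE qs orbT.
have h0 q : q \in s -> 0 <= h q.
  by move=> /hs'[_ kq ->]; rewrite divr_ge0 ?ler0n// subr_ge0 ler_nat ltnW.
have p1 := prime_gt1 pp.
(* The recursion returns to the same [p :: s] with bound [N / p], hence a second induction, on
   [N]. *)
have [n le_N] := ubnP N; elim: n N le_N => // n IHn N le_N.
case: (posnP N) => [->|N0]; first by rewrite smooth_conv0 sqfree_sum0.
apply: le_trans (smooth_conv_cons _ _ _ _ _ pp) _ => /=.
apply: lerD; first exact: IH.
have pk : 0 < p%:R - k%:R :> R by rewrite subr_gt0 ltr_nat.
have kp0 : 0 <= k%:R / p%:R :> R by rewrite divr_ge0 ?ler0n.
have pR : 0 < p%:R :> R by rewrite ltr0n ltnW.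
apply: le_trans (ler_wpM2l kp0 (IHn (N %/ p)%N _)) _.
  have := ltn_Pdiv p1 N0; lia.
rewrite /=; set a := sqfree_sum h s (N %/ p); set b := sqfree_sum h s _.
have ba : b <= a by apply: sqfree_sum_mono => //; apply: leq_div.
have h0p : 0 <= h p by rewrite hp divr_ge0 ?ler0n// ltW.
apply: le_trans (_ : _ <= k%:R / p%:R * (a + h p * a)) _.
  by rewrite ler_wpM2l// lerD2l ler_wpM2l.
rewrite le_eqVlt; apply/orP; left; apply/eqP; rewrite hp; field.
by rewrite !lt0r_neq0.
Qed.

Lemma smooth_conv_mul_ge (R : realFieldType) (s : seq nat) (k w V : nat) :
  smooth_sum (fun n => n%:R^-1) s w * smooth_conv s k V <= smooth_conv s k.+1 (w * V) :> R.
Proof.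
rewrite /smooth_sum big_distrl/=; case: V => [|V].
  by rewrite smooth_conv0 big1 ?muln0 ?smooth_conv_ge0 ?big_geq// => i _; rewrite mulr0.
apply: le_trans (_ : _ <= \sum_(1 <= a < w.+1 | smooth s a) a%:R^-1 * smooth_conv s k (w * V.+1 %/ a)) _.
  rewrite big_nat_cond [leRHS]big_nat_cond; apply: ler_sum => a /andP[/andP[a0 aw] _].
  rewrite ler_wpM2l ?invr_ge0 ?ler0n// smooth_conv_mono// leq_divRL// mulnC leq_mul2r; lia.
apply: sum_nat_widen_le; first by rewrite ltnS leq_pmulr.
by move=> n _; rewrite mulr_ge0 ?invr_ge0 ?ler0n ?smooth_conv_ge0.
Qed.

(** Entries at most [w] have a product at most [w ^ k], so the convolution contains every term of
    the expanded power. The sieving limit [w ^ 3] used later originates here. *)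
Lemma smooth_sum_exp_le_conv (R : realFieldType) (s : seq nat) (k w : nat) : (0 < w)%N ->
  smooth_sum (fun n => n%:R^-1) s w ^+ k <= smooth_conv s k (w ^ k) :> R.
Proof.
move=> w0; elim: k => [|k IH]; first by rewrite expr0 expn0.
rewrite exprS expnS; apply: le_trans (smooth_conv_mul_ge _ _ _ _ _).
by rewrite ler_wpM2l// smooth_sum_ge0// => n n0; rewrite invr_ge0 ler0n.
Qed.

(** * Selberg's sieve *)

(* Squarefree d <= N with prime factors in s, as the sequences of their prime factors. *)
Fixpoint sqfree_seqs (s : seq nat) (N : nat) : seq (seq nat) :=
  if s is p :: s' then sqfree_seqs s' N ++ [seq p :: t | t <- sqfree_seqs s' (N %/ p)]
  else if (0 < N)%N then [:: [::]] else [::].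

Lemma sqfree_sumE (R : realFieldType) (h : nat -> R) (s : seq nat) (N : nat) :
  sqfree_sum h s N = \sum_(t <- sqfree_seqs s N) \prod_(p <- t) h p.
Proof.
elim: s N => [|p s IH] N /=.
  by case: (0 < N)%N; rewrite ?big_seq1 ?big_nil.
rewrite big_cat big_map /= !IH; congr (_ + _).
by rewrite big_distrr; apply: eq_bigr => t _; rewrite big_cons.
Qed.

Lemma sqfree_seqs_subseq (s : seq nat) (N : nat) (t : seq nat) : t \in sqfree_seqs s N -> subseq t s.
Proof.
elim: s N t => [|p s IH] N t /=; first by case: (0 < N)%N; rewrite ?inE.
rewrite mem_cat => /orP[/IH st|/mapP[u /IH su ->]]; last by rewrite eqxx.
exact: subseq_trans st (subseq_cons _ _).
Qed.

Lemma sqfree_seqs_prod_le (s : seq nat) (N : nat) (t : seq nat) :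
  (forall p, p \in s -> (0 < p)%N) -> t \in sqfree_seqs s N -> (\prod_(p <- t) p <= N)%N.
Proof.
elim: s N t => [|p s IH] N t /= hs.
  by case: (posnP N) => // N0; rewrite inE => /eqP->; rewrite big_nil.
have p0 := hs p (mem_head _ _).
have hs' q : q \in s -> (0 < q)%N by move=> qs; apply: hs; rewrite inE qs orbT.
rewrite mem_cat => /orP[/IH->//|/mapP[u /IH su ->]].
by rewrite big_cons mulnC -leq_divRL// su.
Qed.

Lemma sqfree_seqs_uniq (s : seq nat) (N : nat) : uniq s -> uniq (sqfree_seqs s N).
Proof.
elim: s N => [|p s IH] N /=; first by case: (0 < N)%N.
move=> /andP[ps us]; rewrite cat_uniq IH//=  map_inj_uniq ?IH ?andbT//; last by move=> t u [].
apply/hasPn => _ /mapP[u _ ->]; apply/negP => /sqfree_seqs_subseq/mem_subseq/(_ p).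
by rewrite mem_head => /(_ isT) ps'; rewrite ps' in ps.
Qed.

Lemma mem_prime_dvd_prod (s t : seq nat) (p : nat) :
  (forall q, q \in t -> prime q) -> prime p -> (p %| \prod_(q <- t) q)%N = (p \in t).
Proof.
move=> ht pp; rewrite Euclid_dvd_prod// big_has; apply/hasP/idP => [[q qt]|pt]; last by exists p.
by rewrite dvdn_prime2 ?(ht q qt)// => /eqP->.
Qed.

Lemma subseq_eq_mem (s t u : seq nat) : uniq s -> subseq t s -> subseq u s ->
  {in s, t =i u} -> t = u.
Proof.
move=> us /(subseq_uniqP us) -> /(subseq_uniqP us) -> h.
apply: eq_in_filter => p ps /=; have := h p ps.
by rewrite !mem_filter ps !andbT.
Qed.

(** By unique factorization, distinct sequences have distinct products, all between 1 and [N]. *)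
Lemma size_sqfree_seqs (s : seq nat) (N : nat) : uniq s -> (forall p, p \in s -> prime p) ->
  (size (sqfree_seqs s N) <= N)%N.
Proof.
move=> us hs; rewrite -(size_map (fun t => \prod_(p <- t) p)%N) -[leqRHS](size_iota 1).
have sub t p : t \in sqfree_seqs s N -> p \in t -> prime p.
  by move=> /sqfree_seqs_subseq/mem_subseq ts /ts/hs.
apply: uniq_leq_size.
  rewrite map_inj_in_uniq ?sqfree_seqs_uniq// => t u ts us' E.
  apply: (subseq_eq_mem s) => //; [exact: sqfree_seqs_subseq ts|exact: sqfree_seqs_subseq us'|].
  move=> p /hs pp; rewrite -(mem_prime_dvd_prod s)//; last by move=> q; apply: sub.
  by rewrite E mem_prime_dvd_prod// => q; apply: sub.
move=> _ /mapP[t ts ->]; rewrite mem_iota add1n ltnS (sqfree_seqs_prod_le s)// ?andbT.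
  by rewrite big_seq prodn_cond_gt0// => p /(sub _ _ ts)/prime_gt0.
by move=> p /hs/prime_gt0.
Qed.

(** * Mean values of periodic functions *)

Lemma sum_crt (R : realFieldType) (f g : nat -> R) (P Q : nat) :
  (0 < P)%N -> (0 < Q)%N -> coprime P Q ->
  (forall n, f (n %% P)%N = f n) -> (forall n, g (n %% Q)%N = g n) ->
  \sum_(n < P * Q) f n * g n = (\sum_(n < P) f n) * (\sum_(n < Q) g n).
Proof.
move=> P0 Q0 co fP gQ; rewrite big_distrlr /= pair_big /=.
pose r (n : 'I_(P * Q)) := (Ordinal (ltn_pmod n P0), Ordinal (ltn_pmod n Q0)).
have r_inj : injective r.
  move=> m n [] mP mQ; apply: val_inj => /=.
  have : m == n %[mod P * Q] by rewrite chinese_remainder// mP mQ !eqxx.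
  by rewrite !modn_small// => /eqP.
have r_bij : bijective r by apply: inj_card_bij => //; rewrite card_prod !card_ord.
rewrite (reindex r); last exact: onW_bij.
by apply: eq_bigr => n _ /=; rewrite fP gQ.
Qed.

Lemma periodic_prod (R : realFieldType) (F : nat -> nat -> R) (s : seq nat) :
  (forall p n, p \in s -> F p (n %% p)%N = F p n) ->
  forall n, \prod_(p <- s) F p (n %% \prod_(p <- s) p)%N = \prod_(p <- s) F p n.
Proof.
move=> hF n; rewrite big_seq [RHS]big_seq; apply: eq_bigr => p ps.
rewrite -(hF p n ps) -(hF p _ ps); congr (F p _); apply: modn_dvdm.
by rewrite (big_rem p)//= dvdn_mulr.
Qed.

Lemma sum_prod_periodic (R : realFieldType) (F : nat -> nat -> R) (s : seq nat) :
  uniq s -> (forall p, p \in s -> prime p) ->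
  (forall p n, p \in s -> F p (n %% p)%N = F p n) ->
  \sum_(n < \prod_(p <- s) p) \prod_(p <- s) F p n = \prod_(p <- s) \sum_(n < p) F p n.
Proof.
elim: s => [|p s IH] /=; first by rewrite !big_nil big_ord1 big_nil.
move=> /andP[ps us] hs hF.
have hs' q : q \in s -> prime q by move=> qs; apply: hs; rewrite inE qs orbT.
have hF' q n : q \in s -> F q (n %% q)%N = F q n by move=> qs; apply: hF; rewrite inE qs orbT.
have pp := hs p (mem_head _ _).
rewrite !big_cons -IH//; under eq_bigr do rewrite big_cons.
apply: (@sum_crt R (F p) (fun n => \prod_(q <- s) F q n)); first exact: prime_gt0.
- by rewrite big_seq prodn_cond_gt0// => q /hs'/prime_gt0.
- by rewrite prime_coprime// mem_prime_dvd_prod.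
- by move=> n; apply: hF; rewrite mem_head.
- by move=> n; apply: (@periodic_prod R F s) => q m; apply: hF'.
Qed.

(** Complete periods have the exact mean [mu]; the last, incomplete one contributes at most its
    length, which is below [Q]. *)
Lemma sum_periodic_le (R : realFieldType) (f : nat -> R) (mu : R) (Q N : nat) :
  (0 < Q)%N -> (forall n, f (n %% Q)%N = f n) -> (forall n, f n <= 1) -> 0 <= mu ->
  \sum_(n < Q) f n = Q%:R * mu -> \sum_(n < N) f n <= N%:R * mu + Q%:R.
Proof.
move=> Q0 fQ f1 mu0 S; have [n le_N] := ubnP N; elim: n N le_N => // n IH N le_N.
case: (ltnP N Q) => NQ.
  apply: le_trans (_ : _ <= N%:R) _.
    rewrite -[N in leRHS]card_ord -sum1_card natr_sum; exact: ler_sum.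
  by rewrite -[leLHS]add0r lerD ?mulr_ge0 ?ler0n// ler_nat ltnW.
have -> : \sum_(n < N) f n = Q%:R * mu + \sum_(n < N - Q) f n.
  transitivity (\sum_(n < Q + (N - Q)) f n); first by rewrite subnKC.
  rewrite big_split_ord /= S; congr (_ + _).
  by apply: eq_bigr => i _; rewrite -(fQ i) -fQ modnDl.
have NQn : (N - Q < n)%N by lia.
by have := IH _ NQn; rewrite natrB// mulrBl; lra.
Qed.

Definition sieve_char {R : realFieldType} (h : nat -> R) (bad : nat -> pred nat) (t : seq nat) (n : nat) : R :=
  \prod_(p <- t) (if bad p n then -1 else h p).

(* Dual form of Selberg's sieve, without Moebius inversion. Over a full period the functions
   [sieve_char h bad t] are orthogonal with mean square [\prod_(p <- t) h p]; their sum over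
   [t] equals [G = sqfree_sum h s z] at sifted integers, and its second moment over [n < N] is
   at most [N * G + z ^ 4]. *)
Lemma selberg_sieve (R : realFieldType) (k : nat) (bad : nat -> pred nat) (h : nat -> R)
    (s : seq nat) (N z : nat) :
  uniq s ->
  (forall p, p \in s -> [/\ prime p, (0 < k)%N, (2 * k <= p)%N & h p = k%:R / (p%:R - k%:R)]) ->
  (forall p n, p \in s -> bad p (n %% p)%N = bad p n) ->
  (forall p, p \in s -> (\sum_(n < p) bad p n)%N = k) ->
  (0 < z)%N ->
  (\sum_(n < N) all (fun p => ~~ bad p n) s)%N%:R * sqfree_sum h s z <= N%:R + z%:R ^+ 4 :> R.
Proof.
move=> us hs badP badk z0; set D := sqfree_seqs s z; set G := sqfree_sum h s z; set c := (\sum_(n < N) _)%N.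
have hp p : p \in s -> prime p by move=> /hs[].
have kpos p : p \in s -> 0 < p%:R - k%:R :> R.
  by move=> /hs[_ k0 kp _]; rewrite subr_gt0 ltr_nat; lia.
have h01 p : p \in s -> 0 <= h p <= 1.
  move=> ps; have kp := kpos p ps; have [_ k0 k2 ->] := hs p ps.
  rewrite divr_ge0 ?ler0n ?(ltW kp)//= ler_pdivrMr// mul1r.
  by rewrite lerBrDr -natrD ler_nat; lia.
have tD t : t \in D -> {subset t <= s} by move=> /sqfree_seqs_subseq/mem_subseq.
have G1 : 1 <= G.
  rewrite /G; have : {subset s <= s} by [].
  elim: {1 3}s => [|p r IH] rs /=; first by rewrite z0.
  apply: le_trans (IH _) _; first by move=> q qr; apply: rs; rewrite inE qr orbT.
  rewrite lerDl mulr_ge0//; first by have /andP[] := h01 p (rs p (mem_head _ _)).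
  rewrite -(sqfree_sum0 _ h r); apply: sqfree_sum_mono => // q qr.
  have qs : q \in s by apply: rs; rewrite inE qr orbT.
  by have /andP[] := h01 q qs.
have main : c%:R * G ^+ 2 <= N%:R * G + z%:R ^+ 4.
  apply: le_trans (_ : _ <= \sum_(n < N) (\sum_(t <- D) sieve_char h bad t n) ^+ 2) _.
    rewrite /c natr_sum big_distrl /=; apply: ler_sum => n _.
    case: allP => [ok|_]; last by rewrite mul0r sqr_ge0.
    rewrite mul1r le_eqVlt; apply/orP; left; apply/eqP; congr (_ ^+ 2).
    rewrite /G sqfree_sumE big_seq [RHS]big_seq; apply: eq_bigr => t /tD ts.
    by rewrite /sieve_char big_seq [RHS]big_seq; apply: eq_bigr => p /ts/ok/negbTE->.
  under eq_bigr do rewrite expr2 big_distrlr /=.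
  rewrite exchange_big /=; under eq_bigr do rewrite exchange_big /=.
  have pair t u : t \in D -> u \in D ->
    \sum_(n < N) sieve_char h bad t n * sieve_char h bad u n <=
    N%:R * ((t == u)%:R * \prod_(p <- t) h p) + z%:R ^+ 2.
    move=> tD' uD'; have ts := tD t tD'; have us' := tD u uD'.
    pose F p n : R := (if p \in t then if bad p n then -1 else h p else 1) *
                  (if p \in u then if bad p n then -1 else h p else 1).
    pose v := [seq p <- s | (p \in t) || (p \in u)].
    have vs p : p \in v -> p \in s by rewrite mem_filter => /andP[].
    have uv : uniq v by rewrite filter_uniq.
    have tE : t = [seq p <- s | p \in t] by apply/(subseq_uniqP us)/(sqfree_seqs_subseq _ _ _ tD').
    have uE : u = [seq p <- s | p \in u] by apply/(subseq_uniqP us)/(sqfree_seqs_subseq _ _ _ uD').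
    have psiE w n : w = [seq p <- s | p \in w] -> sieve_char h bad w n =
       \prod_(p <- s) (if p \in w then if bad p n then -1 else h p else 1).
      by move=> E; rewrite /sieve_char {1}E big_filter big_mkcond.
    have FE n : sieve_char h bad t n * sieve_char h bad u n = \prod_(p <- v) F p n.
      rewrite !psiE// -big_split /= /v big_filter [RHS]big_mkcond /=.
      apply: eq_bigr => p _; rewrite /F; case: (p \in t); case: (p \in u) => //=.
      by rewrite mulr1.
    rewrite (eq_bigr (fun n : 'I_N => \prod_(p <- v) F p n)); last by move=> n _.
    have FP p n : p \in v -> F p (n %% p)%N = F p n by move=> /vs ps; rewrite /F badP.
    (* [Q] is the least common multiple of the products of [t] and [u], hence a period of the
       product of the two functions. *)
    set Q := (\prod_(p <- v) p)%N.
    have Q0 : (0 < Q)%N by rewrite /Q big_seq prodn_cond_gt0// => p /vs/hp/prime_gt0.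
    have prodE w : w = [seq p <- s | p \in w] ->
      (\prod_(p <- w) p = \prod_(p <- s) if p \in w then p else 1)%N.
      by move=> E; rewrite {1}E big_filter big_mkcond.
    have Qz : Q%:R <= z%:R ^+ 2 :> R.
      rewrite -natrX ler_nat -mulnn; apply: leq_trans (_ : (\prod_(p <- t) p) * (\prod_(p <- u) p) <= _)%N; last first.
        by rewrite leq_mul// (sqfree_seqs_prod_le s)// => p /hp/prime_gt0.
      rewrite !prodE// -big_split /= /Q /v big_filter big_mkcond /= big_seq [leqRHS]big_seq.
      apply: leq_prod => p /hp/prime_gt0 p0.
      by case: (p \in t); case: (p \in u); rewrite //= ?muln1 ?mul1n// leq_pmulr.
    apply: le_trans (_ : _ <= N%:R * ((t == u)%:R * \prod_(p <- t) h p) + Q%:R) _; last by rewrite lerD2l.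
    apply: (@sum_periodic_le R (fun n => \prod_(p <- v) F p n)) => //.
    - by move=> n; apply: (@periodic_prod R F v).
    - move=> n; apply: le_trans (ler_norm _) _; rewrite normr_prod.
      rewrite big_seq; apply: prodr_ile1 => p /vs ps; rewrite normr_ge0 /= /F normrM.
      have /andP[hp0 hp1] := h01 p ps.
      have a1 (b : bool) : `|if b then if bad p n then -1 else h p else 1 : R| <= 1.
        by case: b; [case: ifP|]; rewrite ?normrN ?normr1// ger0_norm.
      by rewrite mulr_ile1.
    - rewrite mulr_ge0 ?ler0n// big_seq prodr_ge0// => p /ts ps.
      by have /andP[] := h01 p ps.
    (* With k bad classes among p, [h p] is the value for which -k + (p - k) h = 0; then k + (p - k)
       h^2 = p h. *)
    have S1 p : p \in s -> \sum_(n < p) (if bad p n then -1 else h p) = 0 :> R /\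
       \sum_(n < p) (if bad p n then -1 else h p) ^+ 2 = p%:R * h p.
      move=> ps; have kp := kpos p ps; have kp' := lt0r_neq0 kp.
      have [_ _ _ hE] := hs p ps.
      have E (a b : R) : \sum_(n < p) (if bad p n then a else b) = k%:R * a + (p%:R - k%:R) * b.
        rewrite -(badk p ps) natr_sum.
        rewrite (eq_bigr (fun n : 'I_p => (bad p n)%:R * (a - b) + b)); last first.
          by move=> n _; case: ifP => _; rewrite ?mul1r ?mul0r ?add0r ?subrK.
        rewrite big_split /= -big_distrl /= sumr_const card_ord -mulr_natl; ring.
      split; first by rewrite E hE; field.
      rewrite (eq_bigr (fun n : 'I_p => if bad p n then 1 else h p ^+ 2)); last first.
        by move=> n _; case: ifP; rewrite ?sqrrN ?expr1n.
      by rewrite E hE; field.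
    rewrite sum_prod_periodic//; last by move=> p /vs/hp.
    case: eqP => [E|ne].
      rewrite mul1r natr_prod.
      have -> : t = v by rewrite {1}tE /v; apply: eq_filter => p; rewrite -E orbb.
      rewrite -big_split /= big_seq [RHS]big_seq; apply: eq_bigr => p pv.
      rewrite -(S1 p (vs p pv)).2; apply: eq_bigr => n _; rewrite /F -E.
      by move: pv; rewrite mem_filter -E orbb => /andP[-> _].
    rewrite mul0r mulr0.
    (* A prime belonging to exactly one of [t] and [u] contributes its vanishing sum as a factor. *)
    have [p pv pd] : exists2 p, p \in v & (p \in t) != (p \in u).
      have [/hasP[p ps pd]|/hasPn no] := boolP (has (fun p => (p \in t) != (p \in u)) s).
        exists p => //; rewrite mem_filter ps andbT.
        by case: (p \in t) pd; case: (p \in u).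
      case: ne; apply: (subseq_eq_mem s) => //; [exact: sqfree_seqs_subseq tD'|exact: sqfree_seqs_subseq uD'|].
      by move=> p /no; rewrite negbK => /eqP.
    rewrite (big_rem p)//= (_ : \sum_(n < p) _ = 0) ?mul0r// -[RHS](S1 p (vs p pv)).1.
    apply: eq_bigr => n _; rewrite /F; move: pd.
    by case: (p \in t); case: (p \in u); rewrite ?mulr1 ?mul1r.
  apply: le_trans (_ : _ <= \sum_(t <- D) \sum_(u <- D)
      (N%:R * ((t == u)%:R * \prod_(p <- t) h p) + z%:R ^+ 2)) _.
    rewrite big_seq [leRHS]big_seq; apply: ler_sum => t td.
    by rewrite big_seq [leRHS]big_seq; apply: ler_sum => u ud; apply: pair.
  have -> : \sum_(t <- D) \sum_(u <- D) (N%:R * ((t == u)%:R * \prod_(p <- t) h p) + z%:R ^+ 2)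
     = N%:R * G + ((size D)%:R * z%:R) ^+ 2.
    have -> : ((size D)%:R * z%:R) ^+ 2 = \sum_(t <- D) \sum_(u <- D) z%:R ^+ 2 :> R.
      have cst (x : R) : \sum_(t <- D) x = (size D)%:R * x.
        by rewrite big_const_seq count_predT iter_addr_0 mulr_natl.
      by rewrite !cst; ring.
    rewrite /G sqfree_sumE big_distrr /= -big_split /= big_seq [RHS]big_seq.
    apply: eq_bigr => t td; rewrite big_split /=; congr (_ + _).
    rewrite -big_distrr -big_distrl /=; congr (_ * _).
    rewrite (_ : \sum_(u <- D) _ = 1) ?mul1r// (big_rem t)//= eqxx big_seq big1 ?addr0// => u.
    by rewrite (mem_rem_uniq _ (sqfree_seqs_uniq _ _ us)) inE eq_sym => /andP[/negbTE-> _].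
  (* There are at most z^2 pairs, each with an error of at most z^2. *)
  rewrite lerD2l -[z%:R ^+ 4]/(z%:R ^+ (2 * 2)) exprM ler_pXn2r// ?nnegrE ?mulr_ge0 ?exprn_ge0 ?ler0n//.
  by rewrite expr2 ler_wpM2r ?ler0n// ler_nat size_sqfree_seqs.
have G0 : 0 < G by apply: lt_le_trans G1.
rewrite -(ler_pM2r G0) -mulrA -expr2; apply: le_trans main _.
by rewrite mulrDl lerD2l ler_peMr// exprn_ge0// ler0n.
Qed.

(** * Structure of the solutions *)

Local Open Scope nat_scope.

(** In the product formula for phi(n), [r] divides either some q - 1 or some q^(v-1) with v >= 2; in
    the latter case q = r. *)
Lemma prime_dvd_totient (r n : nat) : prime r -> 0 < n -> r %| totient n ->
  r ^ 2 %| n \/ exists q, [/\ prime q, q %| n & r %| q.-1].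
Proof.
move=> rp n0; rewrite totientE// Euclid_dvd_prod// big_has => /hasP[q qn].
move: (qn); rewrite mem_primes => /and3P[qp _ qdn].
rewrite Euclid_dvdM// => /orP[rq|]; first by right; exists q.
rewrite Euclid_dvdX// => /andP[rq v0]; left.
move: rq; rewrite dvdn_prime2// => /eqP->.
by rewrite pfactor_dvdn//; lia.
Qed.

Lemma totient_mul_prime (m q : nat) : prime q -> ~~ (q %| m) ->
  totient (m * q) = totient m * q.-1.
Proof.
by move=> qp qm; rewrite totient_coprime ?(totient_prime qp)// coprime_sym prime_coprime.
Qed.

(** If a is the exponent of [P], the totient of [m] is P^(a-1) (P - 1) times the totient of the part
    prime to [P]. A further factor [P] would have to divide P - 1, or q - 1 for a prime q <= P, or
    its square would divide the part prime to [P]. *)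
Lemma max_prime_power_ndvd_totient (P m : nat) : prime P -> 0 < m -> P %| m ->
  (forall r, r \in primes m -> r <= P) -> ~~ (P ^ logn P m %| totient m).
Proof.
move=> Pp m0 Pm mx; apply/negP.
have [m1 cop mE] := pfactor_coprime Pp m0.
have a0 : 0 < logn P m by rewrite logn_gt0 mem_primes Pp m0.
have m10 : 0 < m1 by move: m0; rewrite {1}mE muln_gt0 => /andP[].
rewrite {2}mE totient_coprime; last by rewrite coprime_sym coprimeXl.
rewrite totient_pfactor// -{1}(prednK a0) expnS mulnA.
rewrite dvdn_pmul2r ?expn_gt0 ?prime_gt0// Euclid_dvdM// => /orP[].
  move=> /(prime_dvd_totient _ _ Pp m10)[Pm1|[q [qp qm1 Pq]]].
    by move: cop; rewrite prime_coprime// (dvdn_trans _ Pm1)// dvdn_mulr.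
  have : q <= P by apply: mx; rewrite mem_primes qp m0 {1}mE dvdn_mulr.
  have /= := dvdn_leq _ Pq; have := prime_gt1 qp; lia.
by move=> /dvdn_leq; have := prime_gt1 Pp; lia.
Qed.

Lemma pow2_of_primes_le2 (n : nat) : 0 < n -> (forall r, r \in primes n -> r <= 2) ->
  exists a, n = 2 ^ a.
Proof.
move=> n0 h; exists (logn 2 n); rewrite -p_part part_pnat_id//; apply/pnatP => // r rp rn.
have := h r; rewrite mem_primes rp n0 rn => /(_ isT).
by have := prime_gt1 rp; rewrite inE/=; lia.
Qed.

(* The relation [m * totient m' = m' * totient m] forces [m'] - [m] = [2 * l]; looking
   at the largest prime factor of [m * m'] then shows that both are powers of 2. *)
Lemma degenerate_pair (l m m' q q' : nat) : 0 < l -> prime q -> prime q' ->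
  ~~ (q %| m) -> ~~ (q' %| m') -> 0 < m -> 0 < m' ->
  prime (m * q + l) -> odd (m * q + l) -> m * q + 2 * l = m' * q' ->
  totient (m * q) = totient (m' * q') -> m * totient m' = m' * totient m ->
  [/\ m = 2, q = l.+1 * q'.-1 + 1 & exists j, l.+1 = 2 ^ j].
Proof.
move=> l0 qp q'p qm q'm' m0 m'0 pp po E tE D.
move: tE; rewrite !totient_mul_prime// => tE.
have tm0 : 0 < totient m by rewrite totient_gt0.
(* The totient equation, divided by the proportion [D]. *)
have E1 : m * q.-1 = m' * q'.-1.
  apply/eqP; rewrite -(@eqn_pmul2l (m' * totient m)) ?muln_gt0 ?m'0//; apply/eqP.
  rewrite -[in RHS]D (_ : m' * totient m * (m * q.-1) = m' * m * (totient m * q.-1)); last by ring.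
  by rewrite tE; ring.
have q0 := prime_gt0 qp; have q'0 := prime_gt0 q'p.
have m'E : m' = m + 2 * l.
  have e1 : m * q = m * q.-1 + m by rewrite -mulnSr prednK.
  have e2 : m' * q' = m' * q'.-1 + m' by rewrite -mulnSr prednK.
  lia.
(* A prime dividing both [m] and [l] would divide, hence equal, the prime [m * q + l], which exceeds
   [l]. *)
have cop r : prime r -> r %| m -> ~~ (r %| l).
  move=> rp rm; apply/negP => rl.
  have : r %| m * q + l by rewrite dvdn_add// dvdn_mulr.
  rewrite dvdn_prime2// => /eqP rE; have := dvdn_leq l0 rl.
  by rewrite rE; have : 0 < m * q; rewrite ?muln_gt0 ?m0//; lia.
have mm1 : 1 < m * m' by have := leq_mul m0 (leqnn m'); lia.
have mm0 : 0 < m * m' by apply: ltnW.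
have Pp := max_pdiv_prime mm1; set P := max_pdiv (m * m') in Pp.
have mxm r : r \in primes m -> r <= P.
  move=> rm; apply: max_pdiv_max; rewrite inE; move: rm.
  by rewrite !mem_primes mm0 => /and3P[-> _ rm] /=; rewrite dvdn_mulr.
have mxm' r : r \in primes m' -> r <= P.
  move=> rm; apply: max_pdiv_max; rewrite inE; move: rm.
  by rewrite !mem_primes mm0 => /and3P[-> _ rm] /=; rewrite dvdn_mull.
(* If [P] did not divide [v], its full power in [u] would divide the totient of [u], although [P] is
   the largest possible prime there. *)
have both u v : 0 < u -> P %| u -> (forall r, r \in primes u -> r <= P) ->
    u * totient v = v * totient u -> P %| v.
  move=> u0 Pu mx uv; apply/negPn/negP => Pv.
  have /negP[] := max_prime_power_ndvd_totient P u Pp u0 Pu mx.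
  rewrite -(@Gauss_dvdr _ v); last by rewrite coprimeXl// prime_coprime.
  by rewrite -uv dvdn_mulr// pfactor_dvdnn.
have [Pm Pm'] : P %| m /\ P %| m'.
  have := max_pdiv_dvd (m * m'); rewrite -/P Euclid_dvdM// => /orP[Pm|Pm].
    by split=> //; apply: both mxm D.
  by split=> //; apply: (both m') => //; rewrite D.
have P2 : P = 2.
  have : P %| 2 * l by rewrite -(dvdn_addr _ Pm) -m'E.
  by rewrite Euclid_dvdM// (negbTE (cop P Pp Pm)) orbF dvdn_prime2// => /eqP.
rewrite P2 in Pm Pm' mxm mxm'.
have [a aE] := pow2_of_primes_le2 m m0 mxm.
have [b bE] := pow2_of_primes_le2 m' m'0 mxm'.
have lo : odd l.
  by move: po; rewrite oddD oddM -[odd m]negbK -dvdn2 Pm.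
case: a aE => [|a] aE; first by rewrite aE in Pm.
case: b bE => [|b] bE; first by rewrite bE in Pm'.
rewrite !expnS in aE bE.
(* The difference of [m'] and [m] now gives 2^b - 2^a = l, which is positive and odd. *)
have a0 : a = 0.
  case: a aE => // a; rewrite expnS => aE.
  case: b bE => [|b]; rewrite ?expnS => bE; first by lia.
  lia.
rewrite a0 in aE.
have lE : l.+1 = 2 ^ b by lia.
have m2 : m = 2 by lia.
split=> //; last by exists b.
rewrite m2 in E; have e : m' = 2 * l.+1 by lia.
rewrite e in E; have e2 : l.+1 * q' = l.+1 * q'.-1 + l.+1 by rewrite -mulnSr prednK.
by nia.
Qed.

(** Modulo 3, l + 1 = 2 and l = 1, so the three numbers are t + 1, 2t + 1 and t, and one of them
    vanishes for each residue of t. *)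
Lemma three_dvd_of_odd_exponent (l j t : nat) : l.+1 = 2 ^ j -> odd j ->
  [|| 3 %| t.+1, 3 %| l.+1 * t + 1 | 3 %| 2 * (l.+1 * t + 1) + l].
Proof.
move=> lE jo; have l3 : l.+1 %% 3 = 2.
  have : exists i, j = (2 * i).+1 by exists j./2; lia.
  move=> [i jE]; rewrite lE jE expnS expnM; elim: (i) => [//|i' IH].
  by rewrite expnS; lia.
have : exists c, l = 3 * c + 1 by exists (l %/ 3); lia.
move=> [c cE]; have lt : l.+1 * t = 3 * (c * t) + 2 * t by rewrite cE; ring.
by rewrite lt; lia.
Qed.

Lemma not_pow4_odd_exponent (l j : nat) : 0 < l -> l.+1 = 2 ^ j ->
  ~ (exists2 n, 1 <= n & l = 4 ^ n - 1) -> odd j.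
Proof.
move=> l0 lE h; apply/negPn/negP => je; apply: h; exists j./2.
  by case: j lE je => [|[|j]] //= lE; move: l0; rewrite -ltnS lE.
have jE : j = 2 * j./2 by lia.
by rewrite -(expnM 2 2) -jE -lE subn1.
Qed.

(** * Classification of the solutions *)

Definition primes_upto (y : nat) : seq nat := [seq p <- iota 0 y.+1 | prime p].

Lemma mem_primes_upto (y p : nat) : (p \in primes_upto y) = prime p && (p <= y).
Proof. by rewrite mem_filter mem_iota add0n ltnS. Qed.

Lemma not_smooth_upto (y n : nat) : ~~ smooth (primes_upto y) n ->
  exists q, [/\ prime q, q %| n & y < q].
Proof.
move=> /allPn[q]; rewrite mem_primes => /and3P[qp _ qn] /=.
by rewrite mem_primes_upto qp -ltnNge => yq; exists q.
Qed.

Definition sq_dvd (z n : nat) : Prop := exists2 d, z < d & d ^ 2 %| n.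

(** [j.+1] stands for the large prime factor [q] of [n], in the case that [q - 1] has only small
    prime factors. *)
Definition shifted_smooth_dvd (y z n : nat) : Prop :=
  exists j, [/\ y <= j, smooth (primes_upto z) j & j.+1 %| n].

(** The two divisors stand for [q] and [q']; coprimality is what the Chinese remainder theorem asks
    of them. *)
Definition common_shift_dvd (z W n n' : nat) : Prop :=
  exists r a b, [/\ z < r, (0 < a) && (0 < b), coprime (r * a).+1 (r * b).+1,
    ((r * a).+1 %| n) && ((r * b).+1 %| n') & (r * a).+1 * (r * b).+1 <= W].

(** The last inequality says that [q * q'] exceeds [W], in the form that bounds [m * m']. *)
Definition large_pair (W n n' : nat) : Prop :=
  exists m m' q q', [/\ [/\ prime q, prime q', ~~ (q %| m) & ~~ (q' %| m')],
    n = m * q, n' = m' * q', m * totient m' <> m' * totient m & m * m' * W < n * n'].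

Definition special_prime (l y n : nat) : Prop :=
  exists j t, [/\ l.+1 = 2 ^ j, y < t.+1, y < l.+1 * t + 1, 
    [&& prime t.+1, prime (l.+1 * t + 1) & prime (2 * (l.+1 * t + 1) + l)] & n = 2 * (l.+1 * t + 1)].

Lemma totient_eq_cases (l y z W n : nat) : 0 < l -> 2 * l < y -> z <= y -> 0 < n ->
  prime (n + l) -> odd (n + l) -> totient n = totient (n + 2 * l) ->
  [\/ smooth (primes_upto y) n \/ shifted_smooth_dvd y z n,
      sq_dvd z n \/ sq_dvd z (n + 2 * l),
      common_shift_dvd z W n (n + 2 * l) \/ large_pair W n (n + 2 * l) |
      special_prime l z n].
Proof.
move=> l0 ly zy n0 pp po tE.
have [|/not_smooth_upto[q [qp qn yq]]] := boolP (smooth (primes_upto y) n).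
  by constructor 1; left.
have [qs|/not_smooth_upto[r [rp rq zr]]] := boolP (smooth (primes_upto z) q.-1).
  constructor 1; right; exists q.-1; rewrite prednK ?prime_gt0//; split => //; lia.
have n'0 : 0 < n + 2 * l by lia.
have [q2|q2] := boolP (q ^ 2 %| n).
  by constructor 2; left; exists q => //; apply: leq_ltn_trans yq.
have [m nE] := dvdnP qn.
have qm : ~~ (q %| m) by apply: contra q2 => qm; rewrite nE expnS expn1 dvdn_mul.
have m0 : 0 < m by case: (m) nE n0 => // ->.
have : r %| totient (n + 2 * l) by rewrite -tE nE totient_mul_prime// dvdn_mull.
move=> /(prime_dvd_totient _ _ rp n'0)[r2|[q' [q'p q'n rq']]].
  by constructor 2; right; exists r.
have q0 := prime_gt1 qp; have q'0 := prime_gt1 q'p.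
have rq'l : r < q'.
  by rewrite -(prednK (ltnW q'0)) ltnS; apply: dvdn_leq rq'; rewrite -ltnS prednK // ltnW.
have [q2'|q2'] := boolP (q' ^ 2 %| n + 2 * l).
  by constructor 2; right; exists q' => //; apply: ltn_trans rq'l.
have [m' n'E] := dvdnP q'n.
have q'm' : ~~ (q' %| m') by apply: contra q2' => qm'; rewrite n'E expnS expn1 dvdn_mul.
have m'0 : 0 < m' by case: (m') n'E n'0 => // ->.
(* A common prime would divide [2 * l], which is below [y]. *)
have cop : coprime q q'.
  rewrite prime_coprime// dvdn_prime2//; apply/eqP => qq'.
  have : q %| 2 * l by rewrite -(dvdn_addr _ qn) qq'.
  by move=> /dvdn_leq; rewrite muln_gt0 l0 => /(_ isT) ql; have := leq_ltn_trans ql (ltn_trans ly yq); rewrite ltnn.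
have [a aE] := dvdnP rq; have [b bE] := dvdnP rq'.
have qE : q = (r * a).+1 by rewrite mulnC -aE prednK// ltnW.
have q'E : q' = (r * b).+1 by rewrite mulnC -bE prednK// ltnW.
have [qqW|Wqq] := leqP (q * q') W.
  constructor 3; left; exists r, a, b; rewrite -qE -q'E; split => //; last by rewrite qn.
  by rewrite !lt0n; apply/andP; split; apply/eqP => e0; [move: aE|move: bE]; rewrite e0 mul0n; move: q0 q'0; clear; lia.
have [/eqP D|/eqP ND] := boolP (m * totient m' == m' * totient m); last first.
  constructor 3; right; exists m, m', q, q'; split => //.
  rewrite n'E nE (_ : m * q * (m' * q') = m * m' * (q * q')); last by ring.
  by rewrite ltn_pmul2l// muln_gt0 m0.
rewrite nE in pp po tE n'E; rewrite n'E in tE.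
have [m2 qqE [j jE]] := degenerate_pair l m m' q q' l0 qp q'p qm q'm' m0 m'0 pp po n'E tE D.
constructor 4; exists j, q'.-1; rewrite -qqE prednK; last exact: ltnW.
rewrite m2 in pp nE; split => //.
- exact: ltn_trans zr rq'l.
- exact: leq_ltn_trans yq.
- by rewrite q'p qp pp.
Qed.

Local Open Scope ring_scope.

(** * Counting the exceptional classes *)

Local Open Scope nat_scope.

(** Counting starts at 1 because 0 is smooth and divisible by everything. Predicates are in [Prop],
    since the classes are existential statements. *)
Definition cnt (P : nat -> Prop) (N : nat) : nat := size [seq n <- iota 1 N | `[< P n >]].

Lemma cnt_sum (P : nat -> Prop) (N : nat) : cnt P N = \sum_(1 <= n < N.+1) `[< P n >].
Proof. by rewrite /cnt size_filter -sum1_count big_mkcond /index_iota subn1; apply: eq_bigr => n _; case: ifP. Qed.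

Lemma cnt_mono (P Q : nat -> Prop) (N N' : nat) : N <= N' ->
  (forall n, 0 < n <= N -> P n -> Q n) -> cnt P N <= cnt Q N'.
Proof.
move=> NN PQ; apply: uniq_leq_size; first by rewrite filter_uniq ?iota_uniq.
move=> n; rewrite !mem_filter !mem_iota add1n => /andP[/asboolP Pn /andP[n0 nN]].
rewrite n0 (leq_trans nN) ?andbT//; apply/asboolP/PQ => //.
by rewrite n0.
Qed.

Lemma cnt_inj (T : eqType) (f : nat -> T) (S : seq T) (P : nat -> Prop) (N : nat) :
  (forall m n, 0 < m <= N -> 0 < n <= N -> P m -> P n -> f m = f n -> m = n) ->
  (forall n, 0 < n <= N -> P n -> f n \in S) -> cnt P N <= size S.
Proof.
move=> fi fS; rewrite /cnt -(size_map f); apply: uniq_leq_size.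
  rewrite map_inj_in_uniq ?filter_uniq ?iota_uniq// => m n.
  rewrite !mem_filter !mem_iota !add1n !ltnS => /andP[/asboolP Pm m0] /andP[/asboolP Pn n0].
  exact: fi.
move=> x /mapP[n]; rewrite mem_filter mem_iota add1n ltnS => /andP[/asboolP Pn n0] ->.
exact: fS.
Qed.

Lemma cnt_cover (T : eqType) (S : seq T) (Q : T -> nat -> Prop) (P : nat -> Prop) (N : nat) :
  (forall n, 0 < n <= N -> P n -> exists2 i, i \in S & Q i n) ->
  cnt P N <= \sum_(i <- S) cnt (Q i) N.
Proof.
move=> h; rewrite cnt_sum [leqRHS](eq_bigr _ (fun i _ => cnt_sum (Q i) N)).
rewrite exchange_big /= big_nat [leqRHS]big_nat; apply: leq_sum => n nN.
case: asboolP => // /h[]; first by move: nN; rewrite ltnS.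
by move=> i iS Qi; rewrite (big_rem i)//= asboolT.
Qed.

Lemma cnt_or (P Q : nat -> Prop) (N : nat) : cnt (fun n => P n \/ Q n) N <= cnt P N + cnt Q N.
Proof.
rewrite !cnt_sum -big_split /=; apply: leq_sum => n _.
by case: asboolP => // -[h|h]; rewrite (asboolT h)// addnC.
Qed.

Lemma cnt_shift (P : nat -> Prop) (N c : nat) : cnt (fun n => P (n + c)) N <= cnt P (N + c).
Proof.
apply: (@cnt_inj _ (addn^~ c)); first by move=> m n _ _ _ _ /addIn.
move=> n /andP[n0 nN] Pn; rewrite mem_filter mem_iota asboolT//=.
by rewrite addn_gt0 n0 add1n ltnS leq_add2r.
Qed.

Lemma cnt_congr_le (P : nat -> Prop) (D N : nat) : 0 < D ->
  (forall m n, P m -> P n -> m = n %[mod D]) -> cnt P N <= (N %/ D).+1.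
Proof.
move=> D0 h; rewrite -[leqRHS](size_iota 0); apply: (@cnt_inj _ (divn^~ D)).
  by move=> m n _ _ Pm Pn E; rewrite (divn_eq m D) (divn_eq n D) E (h m n).
by move=> n /andP[_ nN] _; rewrite mem_iota add0n ltnS leq_div2r.
Qed.

Lemma cnt_dvdn (d N : nat) : 0 < d -> cnt (fun n => d %| n) N = N %/ d.
Proof.
move=> d0; rewrite cnt_sum (eq_bigr (fun n => if d %| n then 1 else 0)); last first.
  by move=> n _; rewrite asboolb; case: ifP.
by rewrite -big_mkcond (sum_multiples _ (fun=> 1))// sum_nat_const_nat subn1 muln1.
Qed.

Local Open Scope ring_scope.

Lemma cnt_smooth (R : realFieldType) (s : seq nat) (N : nat) :
  (cnt (smooth s) N)%:R = \sum_(1 <= n < N.+1 | smooth s n) 1 :> R.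
Proof.
by rewrite cnt_sum natr_sum [RHS]big_mkcond; apply: eq_bigr => n _; rewrite asboolb; case: ifP.
Qed.

Lemma ler_div_nat (R : realFieldType) (N d : nat) : (N %/ d)%N%:R <= N%:R / d%:R :> R.
Proof.
case: d => [|d]; first by rewrite divn0 invr0 mulr0.
by rewrite ler_pdivlMr ?ltr0n// -natrM ler_nat leq_trunc_div.
Qed.

Lemma cnt_shifted_smooth_dvd (R : realFieldType) (y z N : nat) : (0 < y)%N ->
  (cnt (shifted_smooth_dvd y z) N)%:R <=
  N%:R * \sum_(y <= j < N.+1 | smooth (primes_upto z) j) j%:R^-1 :> R.
Proof.
move=> y0; apply: le_trans (_ : _ <= (\sum_(j <- [seq j <- index_iota y N.+1 | smooth (primes_upto z) j])
     cnt (fun n => j.+1 %| n) N)%N%:R) _.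
  rewrite ler_nat; apply: cnt_cover => n /andP[n0 nN] [j [yj sm jn]]; exists j => //.
  rewrite mem_filter sm mem_index_iota yj ltnS (leq_trans _ nN)// ltnW//.
  exact: dvdn_leq jn.
rewrite big_filter natr_sum big_distrr big_nat_cond [leRHS]big_nat_cond.
apply: ler_sum => j /andP[/andP[yj _] _]; have j0 := leq_trans y0 yj.
rewrite cnt_dvdn//; apply: le_trans (ler_div_nat _ _ _) _.
by rewrite ler_wpM2l ?ler0n// lef_pV2 ?posrE ?ltr0n// ler_nat.
Qed.

(** Telescoping: 1/(m+1)^2 is at most 1/m - 1/(m+1). *)
Lemma sum_inv_sq_le (R : realFieldType) (z N : nat) : (0 < z)%N ->
  \sum_(z.+1 <= d < N) (d%:R ^+ 2)^-1 <= z%:R^-1 :> R.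
Proof.
move=> z0; case: (leqP N z.+1) => Nz; first by rewrite big_geq// invr_ge0 ler0n.
suff : \sum_(z.+1 <= d < N) (d%:R ^+ 2)^-1 <= z%:R^-1 - N.-1%:R^-1 :> R.
  by move=> /le_trans; apply; rewrite gerBl invr_ge0 ler0n.
have {Nz}-> : N = (z + (N - z.+1)).+1 by lia.
elim: (N - z.+1)%N => [|n IH]; first by rewrite addn0 big_geq// subrr.
rewrite addnS big_nat_recr /=; last by lia.
apply: le_trans (lerD IH (lexx _)) _ => /=.
set m := (z + n)%N; have m0 : (0 < m)%N by rewrite addn_gt0 z0.
have mR : 0 < m%:R :> R by rewrite ltr0n.
rewrite -natr1 -addrA lerD2l -subr_ge0.
have -> : - (m%:R + 1)^-1 - (- m%:R^-1 + ((m%:R + 1) ^+ 2)^-1) = (m%:R * (m%:R + 1) ^+ 2)^-1 :> R.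
  by field; lra.
by rewrite invr_ge0 mulr_ge0 ?exprn_ge0; lra.
Qed.

Lemma cnt_sq_dvd (R : realFieldType) (z N : nat) : (0 < z)%N ->
  (cnt (sq_dvd z) N)%:R <= N%:R / z%:R :> R.
Proof.
move=> z0.
apply: le_trans (_ : _ <= (\sum_(z.+1 <= d < N.+1) cnt (fun n => d ^ 2 %| n) N)%N%:R) _.
  rewrite ler_nat; apply: cnt_cover => n /andP[n0 nN] [d zd dn]; exists d => //.
  rewrite mem_index_iota zd ltnS (leq_trans _ nN)// (leq_trans _ (dvdn_leq n0 dn))//.
  by rewrite -mulnn leq_pmulr//; apply: leq_ltn_trans zd.
apply: le_trans (_ : _ <= N%:R * \sum_(z.+1 <= d < N.+1) (d%:R ^+ 2)^-1) _; last first.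
  by rewrite ler_wpM2l ?ler0n// sum_inv_sq_le.
rewrite natr_sum big_distrr big_nat [leRHS]big_nat; apply: ler_sum => d /andP[zd _].
rewrite cnt_dvdn ?expn_gt0; last by rewrite (leq_ltn_trans _ zd).
by rewrite -natrX; apply: ler_div_nat.
Qed.

Definition harm_sum (R : realFieldType) (N : nat) : R := \sum_(1 <= n < N.+1) n%:R^-1.

Lemma harm_sum_ge0 (R : realFieldType) (N : nat) : 0 <= harm_sum R N.
Proof. by apply: sumr_ge0 => n _; rewrite invr_ge0 ler0n. Qed.

(** For given r, a, b, [n] lies in one class modulo the product of the two divisors. As this product
    is at most [W], there are at most 2W/(r^2 a b) such [n]. Summing over r > z gives 1/z, and a and
    b each give a harmonic sum. *)
Lemma cnt_common_shift_dvd (R : realFieldType) (z W N k : nat) : (0 < z)%N -> (N <= W)%N ->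
  (cnt (fun n => common_shift_dvd z W n (n + k)) N)%:R <=
  2%:R * W%:R * harm_sum R (N + k) ^+ 2 / z%:R :> R.
Proof.
move=> z0 NW; pose M := (N + k)%N.
pose S := [seq (r, ab) | r <- index_iota z.+1 M.+1, ab <- [seq (a, b) | a <- index_iota 1 M.+1, b <- index_iota 1 M.+1]].
pose Q (i : nat * (nat * nat)) (n : nat) := [/\ coprime (i.1 * i.2.1).+1 (i.1 * i.2.2).+1,
   ((i.1 * i.2.1).+1 * (i.1 * i.2.2).+1 <= W)%N, ((i.1 * i.2.1).+1 %| n)%N &
   ((i.1 * i.2.2).+1 %| n + k)%N].
apply: le_trans (_ : _ <= (\sum_(i <- S) cnt (Q i) N)%N%:R) _.
  rewrite ler_nat; apply: cnt_cover => n /andP[n0 nN] [r [a [b [zr /andP[a0 b0] cop /andP[dn dn'] qW]]]].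
  exists (r, (a, b)) => //.
  have r0 : (0 < r)%N by apply: leq_ltn_trans zr.
  have n'0 : (0 < n + k)%N by rewrite addn_gt0 n0.
  have ra : (r * a < M.+1)%N.
    by rewrite (leq_trans (dvdn_leq n0 dn))// (leq_trans nN)// ltnW// ltnS leq_addr.
  have rb : (r * b < M.+1)%N by rewrite (leq_trans (dvdn_leq n'0 dn'))// ltnW// ltnS leq_add2r.
  apply/allpairsPdep; exists r, (a, b); split=> //.
    by rewrite mem_index_iota zr (leq_ltn_trans _ ra)// leq_pmulr.
  apply/allpairsPdep; exists a, b; split=> //; rewrite mem_index_iota.
    by rewrite a0 (leq_ltn_trans _ ra)// leq_pmull.
  by rewrite b0 (leq_ltn_trans _ rb)// leq_pmull.
have bound i : i \in S -> (cnt (Q i) N)%:R <= 2%:R * W%:R * ((i.1%:R ^+ 2)^-1 * (i.2.1%:R^-1 * i.2.2%:R^-1)) :> R.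
  move=> /allpairsPdep[r [ab [rz /allpairsPdep[a [b [a0 b0 ->]]] ->]]] /=.
  move: rz a0 b0; rewrite !mem_index_iota => /andP[zr _] /andP[a0 _] /andP[b0 _].
  have r0 : (0 < r)%N by apply: leq_ltn_trans zr.
  set q := (r * a).+1; set q' := (r * b).+1.
  have tgt0 : 0 <= 2%:R * W%:R * ((r%:R ^+ 2)^-1 * (a%:R^-1 * b%:R^-1)) :> R.
    by rewrite !mulr_ge0 ?invr_ge0 ?exprn_ge0 ?ler0n.
  (* Triples violating either condition contribute nothing. *)
  have [/andP[cop qW]|no] := boolP (coprime q q' && (q * q' <= W)%N); last first.
    rewrite (_ : cnt _ _ = 0%N)//; apply/eqP; rewrite -leqn0.
    apply: (@cnt_inj nat id [::]) => [m n _ _ [c w _ _]|n _ [c w _ _]].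
      by rewrite -/q -/q' in c w; rewrite c w in no.
    by rewrite -/q -/q' in c w; rewrite c w in no.
  have c1 : (cnt (Q (r, (a, b))) N <= (N %/ (q * q')).+1)%N.
    apply: cnt_congr_le => // m n [_ _ /= qm q'm] [_ _ /= qn q'n].
    apply/eqP; rewrite chinese_remainder//; apply/andP; split.
      by move: qm qn; rewrite /dvdn => /eqP-> /eqP->.
    by rewrite -(eqn_modDr k); move: q'm q'n; rewrite /dvdn => /eqP-> /eqP->.
  apply: le_trans (_ : _ <= 2%:R * W%:R / (q * q')%N%:R) _.
    apply: le_trans (_ : _ <= (N %/ (q * q')).+1%:R) _; first by rewrite ler_nat.
    rewrite -natr1 (_ : 2%:R = 1 + 1 :> R)// mulrDl mul1r mulrDl; apply: lerD.
      by apply: le_trans (ler_div_nat _ _ _) _; rewrite ler_wpM2r ?invr_ge0 ?ler0n// ler_nat.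
    by rewrite ler_pdivlMr ?ltr0n// mul1r ler_nat.
  rewrite ler_wpM2l ?mulr_ge0 ?ler0n//.
  rewrite -!invfM lef_pV2 ?posrE ?mulr_gt0 ?exprn_gt0 ?ltr0n//.
  rewrite -natrX -!natrM ler_nat (_ : (r ^ 2 * (a * b) = (r * a) * (r * b))%N); last by ring.
  by rewrite leq_mul.
rewrite natr_sum; apply: le_trans (_ : _ <= \sum_(i <- S)
   2%:R * W%:R * ((i.1%:R ^+ 2)^-1 * (i.2.1%:R^-1 * i.2.2%:R^-1))) _.
  by rewrite big_seq [leRHS]big_seq; apply: ler_sum.
rewrite -big_distrr /= -[leRHS]mulrA ler_wpM2l ?mulr_ge0 ?ler0n// /S big_allpairs_dep /=.
have E r : \sum_(ab <- [seq (a, b) | a <- index_iota 1 M.+1, b <- index_iota 1 M.+1])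
   (r%:R ^+ 2)^-1 * (ab.1%:R^-1 * ab.2%:R^-1) = (r%:R ^+ 2)^-1 * harm_sum R M ^+ 2 :> R.
  by rewrite -big_distrr /= big_allpairs_dep /= [harm_sum R M ^+ 2]expr2 /harm_sum big_distrlr.
under eq_bigr do rewrite E.
by rewrite -big_distrl /= mulrC ler_wpM2l ?exprn_ge0 ?harm_sum_ge0// sum_inv_sq_le.
Qed.

(** The pairs satisfy m m' <= V for V = N(N+k)/W, and the number of such pairs is at most the sum of
    V/m over m <= V. Each pair accounts for at most one [n]. *)
Lemma cnt_large_pair (R : realFieldType) (W N k : nat) : (0 < W)%N ->
  (cnt (fun n => totient n = totient (n + k) /\ large_pair W n (n + k)) N)%:R <=
  (N * (N + k) %/ W)%N%:R * harm_sum R (N * (N + k) %/ W)%N :> R.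
Proof.
move=> W0; set V := (N * (N + k) %/ W)%N.
pose S := [seq (m, m') | m <- index_iota 1 V.+1, m' <- index_iota 1 (V %/ m).+1].
pose Q (i : nat * nat) n := totient n = totient (n + k) /\ exists q q',
  [/\ prime q, prime q', ~~ (q %| i.1)%N & ~~ (q' %| i.2)%N] /\
  [/\ n = i.1 * q, n + k = i.2 * q' & i.1 * totient i.2 <> i.2 * totient i.1]%N.
apply: le_trans (_ : _ <= (\sum_(i <- S) cnt (Q i) N)%N%:R) _.
  rewrite ler_nat; apply: cnt_cover => n /andP[n0 nN] [tE [m [m' [q [q' [pr nE n'E D lt]]]]]].
  exists (m, m'); last by split=> //; exists q, q'.
  have m0 : (0 < m)%N by case: (m) nE n0 => // ->.
  have m'0 : (0 < m')%N by case: (m') n'E n0 => //; lia.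
  have mV : (m * m' <= V)%N.
    rewrite leq_divRL//; apply: leq_trans (ltnW lt) _; rewrite leq_mul// leq_add2r//.
  apply/allpairsPdep; exists m, m'; split=> //; rewrite mem_index_iota.
    by rewrite m0 ltnS (leq_trans _ mV)// leq_pmulr.
  by rewrite m'0 ltnS leq_divRL// mulnC.
have one i : (cnt (Q i) N <= 1)%N.
  apply: (@cnt_inj _ (fun=> tt) [:: tt]) => // n1 n2 /andP[n10 _] /andP[n20 _].
  move=> [t1 [q1 [q1' [[p1 p1' d1 d1'] [e1 e1' D]]]]] [t2 [q2 [q2' [[p2 p2' d2 d2'] [e2 e2' _]]]]] _.
  rewrite e1' e1 !totient_mul_prime// in t1; rewrite e2' e2 !totient_mul_prime// in t2.
  have P1 := prime_gt0 p1; have P1' := prime_gt0 p1'.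
  have P2 := prime_gt0 p2; have P2' := prime_gt0 p2'.
  have m0 : (0 < i.1)%N by case: (i.1) e1 n10 => // ->.
  have key (a b c d : nat) : (i.1 * a + i.2 * d = i.1 * b + i.2 * c)%N ->
     (totient i.1 * a + totient i.2 * d = totient i.1 * b + totient i.2 * c)%N -> a = b.
    move=> X Y; apply/eqP/negPn/negP => ab; apply: D.
    move: i.1 i.2 (totient i.1) (totient i.2) X Y m0 {e1 e1' e2 e2' t1 t2 d1 d1' d2 d2'}.
    move=> m m' f f' X Y m0.
    (* The difference of two solutions lies in the kernel of the system, so the determinant
       annihilates its first coordinate. *)
    have Z : ((a%:Z - b%:Z) * (m%:Z * f'%:Z - m'%:Z * f%:Z) = 0)%R.
      have X' : (m%:Z * (a%:Z - b%:Z) = m'%:Z * (c%:Z - d%:Z))%R by lia.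
      have Y' : (f%:Z * (a%:Z - b%:Z) = f'%:Z * (c%:Z - d%:Z))%R by lia.
      have -> : ((a%:Z - b%:Z) * (m%:Z * f'%:Z - m'%:Z * f%:Z) =
         f'%:Z * (m%:Z * (a%:Z - b%:Z)) - m'%:Z * (f%:Z * (a%:Z - b%:Z)))%R by ring.
      by rewrite X' Y'; ring.
    move/eqP: Z; rewrite mulf_eq0 => /orP[|]; first by lia.
    by lia.
  rewrite e1 e2; congr (_ * _)%N; rewrite -(prednK P1) -(prednK P2); congr _.+1.
  apply: (key _ _ q1'.-1 q2'.-1).
    move: e1 e1' e2 e2'; rewrite -(prednK P1) -(prednK P1') -(prednK P2) -(prednK P2') !mulnS /=.
    move: (i.1 * q1.-1)%N (i.1 * q2.-1)%N (i.2 * q1'.-1)%N (i.2 * q2'.-1)%N i.1 i.2.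
    by clear; lia.
  by rewrite t1 t2 addnC.
apply: le_trans (_ : _ <= (\sum_(i <- S) 1)%N%:R) _; first by rewrite ler_nat; apply: leq_sum.
rewrite big_allpairs_dep /= natr_sum big_distrr /=; apply: ler_sum => m _.
by rewrite sum_nat_const_nat subn1 muln1; apply: ler_div_nat.
Qed.

(** * Reciprocals of primes and Rankin's trick *)

Lemma harm_sum_le (R : realType) (N : nat) (x : R) : 1 <= x -> N%:R <= x -> harm_sum R N <= 1 + ln x.
Proof.
move=> x1 Nx; have x0 : 0 < x by lra.
case: N Nx => [|N] Nx; first by rewrite /harm_sum big_geq// addr_ge0// ln_ge0.
apply: le_trans (_ : _ <= 1 + ln N.+1%:R) _; last first.
  by rewrite lerD2l ler_ln ?posrE ?ltr0n.
elim: N {Nx} => [|N IH]; first by rewrite /harm_sum big_nat1 invr1 ln1 addr0.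
rewrite /harm_sum big_nat_recr//= -/(harm_sum R N.+1).
apply: le_trans (lerD IH (lexx _)) _; rewrite -addrA lerD2l.
have h : -1 < - (N.+2%:R)^-1 :> R by rewrite ltrN2 invf_lt1 ?ltr0n// ltr1n.
have := le_ln1Dx h; rewrite (_ : 1 - _ = N.+1%:R / N.+2%:R); last first.
  have a0 : 0 < N.+1%:R :> R by rewrite ltr0n.
  by rewrite -[N.+2%:R]natr1; move: N.+1%:R a0 => a a0; field; lra.
rewrite ln_div ?posrE ?ltr0n//.
by move: (ln N.+1%:R) (ln N.+2%:R) (N.+2%:R^-1) => a b c; lra.
Qed.

Lemma harm_sum_ge (R : realType) (N : nat) : ln N.+1%:R <= harm_sum R N.
Proof.
elim: N => [|N IH]; first by rewrite /harm_sum big_geq// ln1.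
rewrite /harm_sum big_nat_recr//= -/(harm_sum R N); apply: le_trans (lerD IH (lexx _)).
have a0 : 0 < N.+1%:R :> R by rewrite ltr0n.
have h : -1 < (N.+1%:R)^-1 :> R by rewrite (@lt_trans _ _ 0)// ?invr_gt0// ltrN10.
rewrite -lerBlDl -ln_div ?posrE ?ltr0n//; apply: le_trans (le_ln1Dx h).
by rewrite -[N.+2%:R]natr1 mulrDl divff ?mul1r// lt0r_neq0.
Qed.

Lemma expR_half_le2 (R : realType) : expR (1 / 2%:R) <= 2 :> R.
Proof.
have h := @expR_ge1Dx R (- (1 / 2%:R)).
have := expRxMexpNx_1 (1 / 2%:R : R); have := @expR_gt0 R (1 / 2%:R); nra.
Qed.

Lemma prod_primes_dvdn (s : seq nat) (n : nat) : uniq s ->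
  (forall p, p \in s -> prime p /\ (p %| n)%N) -> (\prod_(p <- s) p %| n)%N.
Proof.
elim: s => [|p s IH] /=; first by rewrite big_nil dvd1n.
move=> /andP[ps us] hs; rewrite big_cons.
have hs' q : q \in s -> prime q /\ (q %| n)%N by move=> qs; apply: hs; rewrite inE qs orbT.
have [pp pn] := hs p (mem_head _ _).
rewrite Gauss_dvd ?pn ?IH// prime_coprime// mem_prime_dvd_prod// => q /hs'[].
by [].
Qed.

Lemma central_bin_le (m : nat) : ('C(2 * m, m) <= 4 ^ m)%N.
Proof.
rewrite -(expnM 2 2) -[(2 ^ _)%N]/((1 + 1) ^ (2 * m))%N expnDn.
rewrite (bigD1 (inord m)) //= inordK ?ltnS ?leq_pmull// !exp1n !muln1.
exact: leq_addr.
Qed.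

Lemma prime_dvd_fact (p n : nat) : prime p -> (p %| n`!)%N -> (p <= n)%N.
Proof.
move=> pp; elim: n => [|n IH]; first by rewrite fact0 Euclid_dvd1.
rewrite factS Euclid_dvdM// => /orP[/dvdn_leq->//|/IH/leq_trans->//].
Qed.

(* Chebyshev: the primes in (2^i, 2^(i+1)] all divide a central binomial coefficient. *)
Lemma count_primes_dyadic (i : nat) :
  (i * count prime (iota (2 ^ i).+1 (2 ^ i)) <= 2 ^ i.+1)%N.
Proof.
set m := (2 ^ i)%N; have m0 : (0 < m)%N by rewrite expn_gt0.
set s := [seq p <- iota m.+1 m | prime p].
rewrite -size_filter -/s -(@leq_exp2l 2)// expnM -/m.
have : (\prod_(p <- s) p <= 'C(2 * m, m))%N.
  apply: dvdn_leq; first by rewrite bin_gt0 leq_pmull.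
  apply: prod_primes_dvdn; first by rewrite filter_uniq// iota_uniq.
  move=> p; rewrite mem_filter mem_iota => /and3P[pp pm p2m]; split=> //.
  have : (p %| (2 * m)`!)%N by apply: dvdn_fact; rewrite prime_gt0//; lia.
  rewrite -(@bin_fact (2 * m) m) ?leq_pmull// !Euclid_dvdM//.
  have -> : (2 * m - m = m)%N by lia.
  by case/or3P => // /(prime_dvd_fact _ _ pp); lia.
move=> h; rewrite expnS expnM -/m; apply: leq_trans (leq_trans h (central_bin_le m)).
have : {subset s <= [pred p | m <= p]%N}.
  by move=> p; rewrite mem_filter mem_iota inE => /and3P[_ /ltnW].
elim: (s) => [|p t IH] st; first by rewrite big_nil expn0.
rewrite big_cons /= expnS leq_mul//; first by have := st p (mem_head _ _).
by apply: IH => q qt; apply: st; rewrite inE qt orbT.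
Qed.

Definition prime_inv_sum (R : realType) (y : nat) : R := \sum_(p <- primes_upto y) p%:R^-1.

Lemma prime_inv_sum_mono (R : realType) (y y' : nat) : (y <= y')%N -> prime_inv_sum R y <= prime_inv_sum R y'.
Proof.
move=> yy; rewrite /prime_inv_sum /primes_upto !big_filter.
have -> : iota 0 y.+1 = index_iota 0 y.+1 by rewrite /index_iota subn0.
have -> : iota 0 y'.+1 = index_iota 0 y'.+1 by rewrite /index_iota subn0.
by apply: sum_nat_widen_le => // n _; rewrite invr_ge0 ler0n.
Qed.

(** By the dyadic count, the primes between 2^i and 2^(i+1) contribute at most 2/i. *)
Lemma prime_inv_sum_pow2_le (R : realType) (j : nat) : prime_inv_sum R (2 ^ j.+1) <= 1 + 2%:R * harm_sum R j.
Proof.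
elim: j => [|j IH].
  rewrite /prime_inv_sum /harm_sum (_ : primes_upto _ = [:: 2%N])// big_seq1 big_geq// mulr0 addr0.
  by rewrite invf_le1 ?ltr0n// ler1n.
have E : prime_inv_sum R (2 ^ j.+2) = prime_inv_sum R (2 ^ j.+1) +
    \sum_(p <- [seq p <- iota (2 ^ j.+1).+1 (2 ^ j.+1) | prime p]) p%:R^-1.
  by rewrite /prime_inv_sum /primes_upto (_ : (2 ^ j.+2).+1 = (2 ^ j.+1).+1 + 2 ^ j.+1)%N
     ?iotaD ?filter_cat ?big_cat// [(2 ^ j.+2)%N]expnS; lia.
rewrite E /harm_sum big_nat_recr//= -/(harm_sum R j) mulrDr addrA; apply: lerD IH _.
set m := (2 ^ j.+1)%N; have m0 : (0 < m)%N by rewrite expn_gt0.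
have mR : 0 < m%:R :> R by rewrite ltr0n.
apply: le_trans (_ : _ <= \sum_(p <- [seq p <- iota m.+1 m | prime p]) m%:R^-1) _.
  rewrite big_seq [leRHS]big_seq; apply: ler_sum => p.
  rewrite mem_filter mem_iota => /and3P[_ mp _].
  by have p0 := ltn_trans m0 mp; rewrite lef_pV2 ?posrE ?ltr0n// ler_nat ltnW.
rewrite big_const_seq count_predT iter_addr_0 size_filter -[_ *+ _]mulr_natl.
rewrite ler_pdivrMr// mulrAC ler_pdivlMr ?ltr0n//.
rewrite -!natrM ler_nat mulnC; apply: leq_trans (count_primes_dyadic _) _.
by rewrite expnS.
Qed.

Lemma prime_inv_sum_le (R : realType) (y : nat) (Y : R) : 1 <= Y -> y%:R <= expR Y ->
  prime_inv_sum R y <= 3%:R + 2%:R * ln (2%:R * Y + 1).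
Proof.
move=> Y1 yY; set j := Num.truncn (2%:R * Y).
have j1 : 2%:R * Y < j.+1%:R by apply: truncnS_gt.
have j2 : j%:R <= 2%:R * Y by rewrite truncn_le; lra.
have yj : (y <= 2 ^ j.+1)%N.
  rewrite -(ler_nat R); apply: le_trans yY _; rewrite natrX.
  (* Since j + 1 > 2Y, exp Y is at most exp(1/2)^(j+1), and exp(1/2) <= 2. *)
  apply: le_trans (_ : _ <= expR (1 / 2%:R) ^+ j.+1) _.
    by rewrite -expRM_natr ler_expR; lra.
  by rewrite lerXn2r ?nnegrE ?expR_ge0// expR_half_le2.
apply: le_trans (prime_inv_sum_mono R _ _ yj) _; apply: le_trans (prime_inv_sum_pow2_le _ _) _.
have := @harm_sum_le R j (2%:R * Y + 1); have -> : 1 <= 2%:R * Y + 1 by lra.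
have -> : j%:R <= 2%:R * Y + 1 by lra.
by move=> /(_ isT isT); lra.
Qed.

(* [n ^ (4 / Y - 1)]: for [p <= exp Y] the factor [p ^ (4 / Y)] is at most [exp 4]. *)
Definition rankin_weight {R : realType} (Y : R) (n : nat) : R :=
  expR (4%:R / Y * ln n%:R) / n%:R.

(** A bound for the Euler product of the weights over p <= exp Y: each factor is at most exp(4 e^4 /
    p), and the last bracket bounds the sum of 1/p. *)
Definition rankin_const {R : realType} (Y : R) : R :=
  expR (4%:R * expR 4%:R * (3%:R + 2%:R * ln (2%:R * Y + 1))).

Lemma rankin_weight_ge0 (R : realType) (Y : R) (n : nat) : 0 <= rankin_weight Y n.
Proof. by rewrite divr_ge0 ?expR_ge0 ?ler0n. Qed.

Lemma rankin_weightM (R : realType) (Y : R) (m n : nat) : (0 < m)%N -> (0 < n)%N ->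
  rankin_weight Y (m * n) = rankin_weight Y m * rankin_weight Y n.
Proof.
move=> m0 n0; rewrite /rankin_weight natrM lnM ?posrE ?ltr0n// mulrDr expRD invfM.
by rewrite mulrACA.
Qed.

(** As 4/Y <= 1/2, the weight of p is at most p^(-1/2), which is below 3/4 already at p = 2. *)
Lemma rankin_weight_le (R : realType) (Y : R) (p : nat) : 8%:R <= Y -> (1 < p)%N ->
  p%:R <= expR Y -> rankin_weight Y p <= 3%:R / 4%:R /\ rankin_weight Y p <= expR 4%:R / p%:R.
Proof.
move=> Y8 p1 pY; have p0 : 0 < p%:R :> R by rewrite ltr0n ltnW.
have Y0 : 0 < Y by lra.
have p2 : 2%:R <= p%:R :> R by rewrite ler_nat.
have lnp : 0 <= ln p%:R :> R by rewrite ln_ge0//; lra.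
split; rewrite /rankin_weight.
  rewrite ler_pdivrMr//.
  apply: le_trans (_ : _ <= expR (1 / 2%:R * ln p%:R)) _.
    by rewrite ler_expR ler_wpM2r// ler_pdivrMr//; lra.
  have : expR (1 / 2%:R * ln p%:R) * expR (1 / 2%:R * ln p%:R) = p%:R :> R.
    by rewrite -expRD -[RHS]lnK ?posrE//; congr expR; field.
  have := @expR_gt0 R (1 / 2%:R * ln p%:R).
  move: (expR _) => E E0 EE; have E2 : 2%:R <= E * E by rewrite EE.
  by rewrite -EE; nra.
rewrite ler_wpM2r ?invr_ge0 ?ler0n// ler_expR.
rewrite -[leRHS]mulr1 -mulrA ler_pM2l ?ltr0n// ler_pdivrMl// mulr1.
by rewrite -ler_expR lnK.
Qed.

Lemma smooth_sum_rankin_le (R : realType) (Y : R) (y N : nat) : 8%:R <= Y -> y%:R <= expR Y ->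
  smooth_sum (rankin_weight Y) (primes_upto y) N <= rankin_const Y.
Proof.
move=> Y8 yY.
have wp p : p \in primes_upto y -> rankin_weight Y p <= 3%:R / 4%:R /\ rankin_weight Y p <= expR 4%:R / p%:R.
  rewrite mem_primes_upto => /andP[pp py]; apply: rankin_weight_le => //; first exact: prime_gt1.
  by apply: le_trans yY; rewrite ler_nat.
apply: le_trans (smooth_sum_prod _ _ _ _ _ _ _ _) _.
- by move=> n _; apply: rankin_weight_ge0.
- by rewrite /rankin_weight ln1 mulr0 expR0 divr1.
- exact: rankin_weightM.
- move=> p ps; split; first by move: ps; rewrite mem_primes_upto => /andP[].
  by have [h _] := wp p ps; apply: le_lt_trans h _; lra.
apply: le_trans (_ : _ <= \prod_(p <- primes_upto y) expR (4%:R * (expR 4%:R / p%:R))) _.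
  rewrite big_seq [leRHS]big_seq; apply: ler_prod => p /wp[].
  have := rankin_weight_ge0 _ Y p; move: (rankin_weight Y p) => g g0 g34 ge.
  have g1 : 0 < 1 - g by lra.
  (* For 0 <= g <= 3/4 one has 1/(1 - g) <= 1 + 4g <= exp(4g). *)
  rewrite invr_ge0 (ltW g1) /=; apply: le_trans (_ : _ <= expR (4%:R * g)) _; last first.
    by rewrite ler_expR ler_pM2l.
  apply: le_trans (expR_ge1Dx _); rewrite -[leLHS]mul1r ler_pdivrMr//; nra.
rewrite -expR_sum ler_expR -big_distrr /= -big_distrr /= -/(prime_inv_sum R y) -mulrA.
by rewrite !ler_pM2l ?expR_gt0// prime_inv_sum_le//; lra.
Qed.

(** Each n <= N is counted with the weight (N/n)^(1 - 4/Y), which is at least 1 because 4/Y <= 1. *)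
Lemma cnt_smooth_le (R : realType) (Y : R) (y N : nat) : 8%:R <= Y -> y%:R <= expR Y ->
  (0 < N)%N ->
  (cnt (smooth (primes_upto y)) N)%:R <=
  N%:R * expR (- (4%:R / Y * ln N%:R)) * rankin_const Y.
Proof.
move=> Y8 yY N0; have Y0 : 0 < Y by lra.
rewrite cnt_smooth; apply: le_trans (ler_wpM2l _ (smooth_sum_rankin_le _ _ _ N Y8 yY)); last first.
  by rewrite mulr_ge0 ?expR_ge0 ?ler0n.
rewrite /smooth_sum big_distrr /= big_nat_cond [leRHS]big_nat_cond.
apply: ler_sum => n /andP[/andP[n0 nN] _]; have nR : 0 < n%:R :> R by rewrite ltr0n.
have NR : 0 < N%:R :> R by rewrite ltr0n.
rewrite /rankin_weight [leRHS]mulrA ler_pdivlMr// mul1r -[leRHS]mulrA -expRD.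
rewrite -{1}(@lnK _ n%:R) ?posrE// -{1}(@lnK _ N%:R) ?posrE// -expRD ler_expR.
have : ln n%:R <= ln N%:R :> R by rewrite ler_ln ?posrE// ler_nat.
have : 4%:R / Y <= 1 by rewrite ler_pdivrMr//; lra.
by move: (4%:R / Y) (ln n%:R) (ln N%:R) => e a b; nra.
Qed.

(** Each j >= w is weighted by (j/w)^(4/Y) >= 1. *)
Lemma smooth_tail_le (R : realType) (Y : R) (y w N : nat) : 8%:R <= Y -> y%:R <= expR Y ->
  (0 < w)%N ->
  \sum_(w <= j < N.+1 | smooth (primes_upto y) j) j%:R^-1 <=
  expR (- (4%:R / Y * ln w%:R)) * rankin_const Y.
Proof.
move=> Y8 yY w0; have Y0 : 0 < Y by lra.
apply: le_trans (ler_wpM2l (expR_ge0 _) (smooth_sum_rankin_le _ _ _ N Y8 yY)).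
rewrite /smooth_sum big_distrr /=.
apply: le_trans (_ : _ <= \sum_(w <= j < N.+1 | smooth (primes_upto y) j)
    expR (- (4%:R / Y * ln w%:R)) * rankin_weight Y j) _.
  rewrite big_nat_cond [leRHS]big_nat_cond; apply: ler_sum => j /andP[/andP[wj _] _].
  have jR : 0 < j%:R :> R by rewrite ltr0n (leq_trans w0).
  have wR : 0 < w%:R :> R by rewrite ltr0n.
  rewrite /rankin_weight mulrA -[leLHS]mul1r ler_pM2r ?invr_gt0// -expRD.
  rewrite -[leLHS]expR0 ler_expR addrC subr_ge0 ler_wpM2l ?divr_ge0 ?ler0n ?(ltW Y0)//.
  by rewrite ler_ln ?posrE// ler_nat.
case: (leqP w N.+1) => wN; last first.
  rewrite (big_geq (ltnW wN)); apply: sumr_ge0 => n _.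
  by rewrite mulr_ge0 ?expR_ge0 ?rankin_weight_ge0.
rewrite [leRHS](big_cat_nat w0 wN)//= lerDr sumr_ge0// => n _.
by rewrite mulr_ge0 ?expR_ge0 ?rankin_weight_ge0.
Qed.

(** * The prime triples *)

Lemma linear_root (p c d : nat) : prime p -> ~~ (p %| c)%N ->
  exists2 a, (a < p)%N & forall n, (n < p)%N -> (p %| c * n + d)%N = (n == a).
Proof.
move=> pp pc; have p0 := prime_gt0 pp.
pose f (i : 'I_p) := Ordinal (ltn_pmod (c * i + d) p0).
have key m n : (m <= n)%N -> (n < p)%N -> c * m + d = c * n + d %[mod p] -> m = n.
  move=> mn np /eqP; rewrite eqn_modDr eq_sym eqn_mod_dvd ?leq_mul// -mulnBr.
  rewrite Euclid_dvdM// (negbTE pc) /=; case: (posnP (n - m)) => [h _|h /(dvdn_leq h)]; lia.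
have f_inj : injective f.
  move=> m n [] E; apply: val_inj => /=.
  case: (leqP m n) => mn; first by apply: key mn _ E.
  by apply/esym/(key _ _ (ltnW mn)).
have [g fK gK] := injF_bij f_inj.
have aE : (p %| c * g (Ordinal p0) + d)%N by rewrite /dvdn; have /(congr1 val) /= -> := gK (Ordinal p0).
exists (g (Ordinal p0)) => // n np; apply/idP/eqP => [h|->//].
have E : c * n + d = c * g (Ordinal p0) + d %[mod p] by move: h aE; rewrite /dvdn => /eqP-> /eqP->.
case: (leqP n (g (Ordinal p0))) => ng; first by apply: key ng _ E.
by apply/esym/(key _ _ (ltnW ng)).
Qed.

Definition triple_bad (l p t : nat) : bool :=
  [|| p %| t.+1, p %| l.+1 * t + 1 | p %| 2 * (l.+1 * t + 1) + l]%N.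

Lemma triple_bad_mod (l p t : nat) : triple_bad l p (t %% p) = triple_bad l p t.
Proof.
have E (c d : nat) : (p %| c * (t %% p) + d)%N = (p %| c * t + d)%N.
  by rewrite /dvdn -modnDml modnMmr modnDml.
have h1 (s : nat) : (s.+1 = 1 * s + 1)%N by rewrite mul1n addn1.
have h3 (s : nat) : (2 * (l.+1 * s + 1) + l = 2 * l.+1 * s + (2 + l))%N by ring.
by rewrite /triple_bad h1 [in RHS]h1 !h3 !E.
Qed.

(** Each form has one root modulo [p]. Eliminating t between any two forms leaves [l], which [p]
    does not divide, so the roots are distinct. *)
Lemma triple_bad_count (l p : nat) : (0 < l)%N -> prime p -> (2 * l.+1 < p)%N ->
  (\sum_(t < p) triple_bad l p t = 3)%N.
Proof.
move=> l0 pp lp.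
have ndvd c : (0 < c)%N -> (c < p)%N -> ~~ (p %| c)%N.
  by move=> c0 cp; apply/negP => /(dvdn_leq c0); rewrite leqNgt cp.
have pl : ~~ (p %| l)%N by apply: ndvd => //; lia.
have [a1 a1p h1] := linear_root p 1 1 pp (ndvd 1%N isT (prime_gt1 pp)).
have [a2 a2p h2] : exists2 a, (a < p)%N & forall n, (n < p)%N -> (p %| l.+1 * n + 1)%N = (n == a).
  by apply: linear_root => //; apply: ndvd => //; lia.
have [a3 a3p h3] : exists2 a, (a < p)%N & forall n, (n < p)%N -> (p %| 2 * l.+1 * n + (2 + l))%N = (n == a).
  by apply: linear_root => //; apply: ndvd => //; lia.
have e1 := h1 _ a1p; have e2 := h2 _ a2p; have e3 := h3 _ a3p; rewrite !eqxx in e1 e2 e3.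
have a12 : a1 != a2.
  apply: contra pl => /eqP a; rewrite -a in e2.
  have : (p %| l.+1 * (1 * a1 + 1))%N by rewrite dvdn_mull.
  by rewrite (_ : (l.+1 * (1 * a1 + 1) = (l.+1 * a1 + 1) + l)%N); [rewrite (dvdn_addr _ e2)|ring].
have a13 : a1 != a3.
  apply: contra pl => /eqP a; rewrite -a in e3.
  have : (p %| 2 * l.+1 * (1 * a1 + 1))%N by rewrite dvdn_mull.
  by rewrite (_ : (2 * l.+1 * (1 * a1 + 1) = (2 * l.+1 * a1 + (2 + l)) + l)%N); [rewrite (dvdn_addr _ e3)|ring].
have a23 : a2 != a3.
  apply: contra pl => /eqP a; rewrite -a in e3.
  have h : (p %| 2 * (l.+1 * a2 + 1))%N by rewrite dvdn_mull.
  by move: e3; rewrite (_ : (2 * l.+1 * a2 + (2 + l) = 2 * (l.+1 * a2 + 1) + l)%N); [rewrite (dvdn_addr _ h)|ring].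
rewrite (eq_bigr (fun t : 'I_p => (t == a1 :> nat) + (t == a2 :> nat) + (t == a3 :> nat)))%N; last first.
  move=> t _; rewrite /triple_bad.
  have -> : (t.+1 = 1 * t + 1)%N by lia.
  have -> : (2 * (l.+1 * t + 1) + l = 2 * l.+1 * t + (2 + l))%N by ring.
  rewrite h1// h2// h3//.
  case: eqP => [->|_]; first by rewrite (negbTE a12) (negbTE a13).
  case: eqP => [->|_]; first by rewrite (negbTE a23).
  by case: eqP.
have one a : (a < p)%N -> (\sum_(t < p) (t == a :> nat) = 1)%N.
  move=> ap; rewrite (bigD1 (Ordinal ap))//= eqxx big1// => t.
  by rewrite -val_eqE /= => /negbTE->.
by rewrite !big_split /= !one.
Qed.

(* [t] is recovered from [n = 2 (M t + 1)]; once [t >= z], all three primes exceed the sieving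
   limit [z]. *)
Lemma cnt_special_prime_le (l z y N : nat) : (0 < l)%N -> (0 < z)%N ->
  (cnt (special_prime l y) N <= z +
    \sum_(t < N) all (fun p => ~~ triple_bad l p t) [seq p <- primes_upto z | 6 * l.+1 < p])%N.
Proof.
move=> l0 z0; set s := [seq p <- _ | _].
pose S := index_iota 0 z ++ [seq t <- index_iota 0 N | all (fun p => ~~ triple_bad l p t) s].
apply: leq_trans (_ : size S <= _)%N; last first.
  rewrite size_cat size_iota subn0 leq_add2l size_filter -sum1_count big_mkcond big_mkord.
  by apply: leq_sum => t _; case: ifP.
have fE t : (((2 * (l.+1 * t + 1)) %/ 2).-1 %/ l.+1 = t)%N by rewrite mulKn// addn1 /= mulKn.
apply: (@cnt_inj _ (fun n => (n %/ 2).-1 %/ l.+1)%N).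
  move=> m n _ _ [j [t [_ _ _ _ ->]]] [j' [t' [_ _ _ _ ->]]]; rewrite !fE => ->.
  by [].
move=> n /andP[_ nN] [j [t [_ _ _ /and3P[p1 p2 p3] nE]]]; rewrite nE fE mem_cat mem_index_iota /=.
case: (ltnP t z) => //= tz; rewrite mem_filter mem_index_iota /=.
have tN : (t < N)%N by apply: leq_trans nN; rewrite nE mulSn; lia.
rewrite tN andbT; apply/allP => p; rewrite mem_filter mem_primes_upto => /and3P[_ pp pz].
have no q : prime q -> (z < q)%N -> ~~ (p %| q)%N.
  move=> qp zq; rewrite dvdn_prime2//; apply/eqP => pq; rewrite pq in pz; lia.
have tM : (t <= l.+1 * t)%N by rewrite leq_pmull.
by rewrite /triple_bad !negb_or !no//; lia.
Qed.

(** The factor lost by not sieving by primes up to 6(l+1). Beyond this bound both 2k <= p, with k =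
    3 in the sieve, and 2(l+1) < p, in the root count, hold. *)
Definition triple_const (R : realType) (l : nat) : R :=
  \prod_(p <- primes_upto (6 * l.+1)) (1 - p%:R^-1).

Lemma triple_const_gt0 (R : realType) (l : nat) : 0 < triple_const R l.
Proof.
rewrite /triple_const big_seq; apply: prodr_gt0 => p.
rewrite mem_primes_upto => /andP[/prime_gt1 p1 _].
by rewrite subr_gt0 invf_lt1 ?ltr0n ?ltr1n// ltnW.
Qed.

(** The squarefree sum dominates the threefold convolution, hence the cube of the sum of 1/n over n
    <= w without small prime factors. Restoring the small primes turns the latter into a full
    harmonic sum at the cost of their Euler product. *)
Lemma triple_sqfree_sum_ge (R : realType) (l w : nat) : (0 < w)%N ->
  (triple_const R l * harm_sum R w) ^+ 3 <=
  sqfree_sum (fun p => 3%:R / (p%:R - 3%:R)) [seq p <- primes_upto (w ^ 3) | 6 * l.+1 < p]%N (w ^ 3).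
Proof.
move=> w0; set s := [seq p <- _ | _].
apply: le_trans (_ : _ <= smooth_conv s 3 (w ^ 3)) _; last first.
  apply: smooth_conv_le_sqfree_sum => p; rewrite mem_filter mem_primes_upto => /and3P[lp pp _].
  by split=> //; lia.
apply: le_trans (smooth_sum_exp_le_conv _ _ _ _ w0).
have h0 := harm_sum_ge0 R w; have c0 := triple_const_gt0 R l.
have inv0 n : (0 < n)%N -> 0 <= n%:R^-1 :> R by rewrite invr_ge0 ler0n.
rewrite lerXn2r ?nnegrE ?mulr_ge0 ?(ltW c0)//; first exact: smooth_sum_ge0.
have -> : harm_sum R w = smooth_sum (fun n => n%:R^-1) (primes_upto (6 * l.+1) ++ s) w.
  rewrite /harm_sum /smooth_sum [RHS]big_mkcond [LHS]big_nat [RHS]big_nat; apply: eq_bigr => n /andP[n0 nw].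
  case: ifP => // /negP[]; apply/allP => q; rewrite mem_primes => /and3P[qp _ qn] /=.
  rewrite mem_cat mem_primes_upto /s mem_filter mem_primes_upto qp /=.
  case: (leqP q (6 * l.+1)) => //= _; apply: leq_trans (dvdn_leq n0 qn) _.
  by rewrite -ltnS (leq_trans nw)// ltnS -[leqLHS]expn1 leq_pexp2l.
rewrite mulrC; apply: le_trans (ler_wpM2r (ltW c0) (smooth_sum_cat _ _ _ _ _ inv0 _ _)) _.
- by move=> m n _ _; rewrite natrM invfM.
- move=> p; rewrite mem_primes_upto => /andP[pp _]; split=> //.
  by rewrite invf_lt1 ?ltr0n ?ltr1n ?prime_gt1// prime_gt0.
rewrite mulrAC -[leRHS]mul1r ler_wpM2r ?smooth_sum_ge0// /triple_const -big_split /=.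
rewrite big_seq big1// => p; rewrite mem_primes_upto => /andP[/prime_gt1 p1 _].
by rewrite mulVf// lt0r_neq0// subr_gt0 invf_lt1 ?ltr0n ?ltr1n// ltnW.
Qed.

Lemma triple_sieve (R : realType) (l w N : nat) : (0 < l)%N -> (1 < w)%N ->
  (\sum_(t < N) all (fun p => ~~ triple_bad l p t) [seq p <- primes_upto (w ^ 3) | 6 * l.+1 < p])%N%:R
  <= (N%:R + w%:R ^+ 12) / (triple_const R l * harm_sum R w) ^+ 3.
Proof.
move=> l0 w1; have w0 := ltnW w1.
have h0 : 0 < harm_sum R w.
  by apply: lt_le_trans (harm_sum_ge _ _); rewrite ln_gt0// ltr1n.
have c0 := triple_const_gt0 R l.
rewrite ler_pdivlMr ?exprn_gt0 ?mulr_gt0//.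
apply: le_trans (ler_wpM2l _ (triple_sqfree_sum_ge R l w w0)) _; first exact: ler0n.
rewrite (_ : w%:R ^+ 12 = (w ^ 3)%N%:R ^+ 4); last by rewrite natrX -exprM.
apply: (@selberg_sieve R 3) => //.
- by rewrite filter_uniq// filter_uniq// iota_uniq.
- move=> p; rewrite mem_filter mem_primes_upto => /and3P[lp pp _]; split=> //; lia.
- by move=> p n _; apply: triple_bad_mod.
- move=> p; rewrite mem_filter mem_primes_upto => /and3P[lp pp _].
  by apply: triple_bad_count => //; lia.
- by rewrite expn_gt0 w0.
Qed.

(** * Choice of the parameters *)

(** In terms of n = p - l; the condition l < p is supplied by [cnt], which starts at 1. *)
Definition totient_pair (l n : nat) : Prop :=
  [/\ prime (n + l), odd (n + l) & totient n = totient (n + 2 * l)].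

Lemma totient_count_le (R : realType) (l : nat) (x : R) :
  (totient_count l x <= cnt (totient_pair l) (Num.truncn x))%N.
Proof.
rewrite /totient_count cardE -(size_map (fun p : 'I__ => (p - l)%N)).
apply: uniq_leq_size.
  rewrite map_inj_in_uniq ?enum_uniq// => p q.
  rewrite !mem_enum !inE => /and4P[_ _ lp _] /and4P[_ _ lq _] E; apply: val_inj => /=; lia.
move=> n /mapP[p]; rewrite mem_enum inE => /and4P[pp po lp /eqP tE] ->.
have pN := ltn_ord p; rewrite mem_filter mem_iota; apply/andP; split; last by lia.
apply/asboolP; rewrite /totient_pair subnK ?(ltnW lp)//; split=> //.
by rewrite tE; congr totient; lia.
Qed.

Lemma cnt_totient_pair_le (l y z W N : nat) : (0 < l)%N -> (2 * l < y)%N -> (z <= y)%N ->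
  (cnt (totient_pair l) N <= cnt (smooth (primes_upto y)) N + cnt (shifted_smooth_dvd y z) N +
    (cnt (sq_dvd z) N + cnt (sq_dvd z) (N + 2 * l)) +
    (cnt (fun n => common_shift_dvd z W n (n + 2 * l)) N +
     cnt (fun n => totient n = totient (n + 2 * l) /\ large_pair W n (n + 2 * l)) N) +
    cnt (special_prime l z) N)%N.
Proof.
move=> l0 ly zy.
apply: leq_trans (_ : cnt (fun n => (((smooth (primes_upto y) n \/ shifted_smooth_dvd y z n) \/
   (sq_dvd z n \/ sq_dvd z (n + 2 * l))) \/ (common_shift_dvd z W n (n + 2 * l) \/
    (totient n = totient (n + 2 * l) /\ large_pair W n (n + 2 * l)))) \/ special_prime l z n) N <= _)%N.
  apply: cnt_mono => // n /andP[n0 _] [pp po tE].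
  by have [|||] := totient_eq_cases l y z W n l0 ly zy n0 pp po tE; tauto.
do 3!apply: leq_trans (cnt_or _ _ _) (leq_add _ _) => //.
- exact: cnt_or.
- apply: leq_trans (cnt_or _ _ _) _; rewrite leq_add2l; exact: cnt_shift.
Qed.

(** An integer part t >= 1 is at least (t + 1)/2, so rounding costs less than a factor 2 <= e; this
    is the source of the 1 in the exponents 1 - 2t below. *)
Lemma truncn_expR (R : realType) (u : R) : 0 <= u ->
  [/\ (0 < Num.truncn (expR u))%N, (Num.truncn (expR u))%:R <= expR u &
      expR (u - 1) <= (Num.truncn (expR u))%:R].
Proof.
move=> u0; set t := Num.truncn _.
have t0 : (0 < t)%N by rewrite truncn_gt0 -[leLHS]expR0 ler_expR.
split=> //; first by rewrite truncn_le expR_ge0.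
have h : expR u < t.+1%:R by apply: truncnS_gt.
have t1 : 1 <= t%:R :> R by rewrite ler1n.
have e2 : 2%:R <= expR 1 :> R by have := @expR_ge1Dx R 1; lra.
have : expR u = expR 1 * expR (u - 1) by rewrite -expRD; congr expR; ring.
rewrite -natr1 in h; have := expR_gt0 (u - 1); nra.
Qed.

Lemma expR_ge_pow (R : realType) (n : nat) (x : R) : 0 <= x -> x ^+ n.+1 <= (n.+1)`!%:R * expR x.
Proof.
move=> x0; rewrite mulrC -ler_pdivrMr ?ltr0n ?fact_gt0//.
by apply: le_trans (expR_ge1Dxn n x0); rewrite lerDr.
Qed.

Lemma rankin_const_mono (R : realType) (Y Y' : R) : 0 <= Y -> Y <= Y' ->
  rankin_const Y <= rankin_const Y'.
Proof.
move=> Y0 YY; rewrite /rankin_const ler_expR ler_pM2l ?mulr_gt0 ?expR_gt0//.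
by rewrite lerD2l ler_pM2l// ler_ln ?posrE; lra.
Qed.

(* In fact polynomial in [t], since the exponent is O(log t). *)
Lemma rankin_const_le (R : realType) : exists2 C : R, 0 < C &
  forall t, 2%:R <= t -> rankin_const (2%:R * t ^+ 2) <= C * expR t.
Proof.
set K : R := 4%:R * expR 4%:R.
have K0 : 0 < K by rewrite mulr_gt0 ?expR_gt0.
exists (expR (13%:R * K + 4%:R * K * ln (4%:R * K))); first exact: expR_gt0.
move=> t t2; have t0 : 0 < t by lra.
rewrite /rankin_const -/K -expRD ler_expR.
have K4 : 0 < 4%:R * K by rewrite mulr_gt0.
have h1 : ln (2%:R * (2%:R * t ^+ 2) + 1) <= 5%:R + 2%:R * ln t.
  apply: le_trans (_ : _ <= ln (5%:R * t ^+ 2)) _.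
    by rewrite ler_ln ?posrE; nra.
  rewrite lnM ?posrE ?exprn_gt0// lnXn// mulr_natl lerD2r ltW//.
  by apply: ln_sublinear.
(* This is ln u < u at u = t/(4K), chosen so that the factor 4K leaves exactly t. *)
have h2 : ln t <= ln (4%:R * K) + t / (4%:R * K).
  rewrite -lerBlDl -ln_div ?posrE//; apply/ltW/ln_sublinear.
  by rewrite divr_gt0.
have h3 : 4%:R * K * ln t <= 4%:R * K * ln (4%:R * K) + t.
  apply: le_trans (ler_wpM2l (ltW K4) h2) _; rewrite mulrDr lerD2l mulrCA divff ?mulr1//.
  exact: lt0r_neq0.
have h4 : K * ln (2%:R * (2%:R * t ^+ 2) + 1) <= K * (5%:R + 2%:R * ln t) by rewrite ler_pM2l.
by move: h3 h4; move: (ln t) (ln (4%:R * K)) (ln (_ + _)) => a b c; nra.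
Qed.

(** With Y = 2t^2 and log N >= t^3 - 1, the saving exponent is at least 2t - 2/t^2 >= 2t - 1. *)
Lemma cnt_smooth_param (R : realType) (t : R) : 2%:R <= t ->
  (cnt (smooth (primes_upto (Num.truncn (expR (2%:R * t ^+ 2))))) (Num.truncn (expR (t ^+ 3))))%:R
  <= expR (t ^+ 3) * expR (1 - 2%:R * t) * rankin_const (2%:R * t ^+ 2).
Proof.
move=> t2; have t0 : 0 < t by lra.
have [_ yu _] := truncn_expR R (2%:R * t ^+ 2) (ltac:(nra)).
have [N0 Nu Nl] := truncn_expR R (t ^+ 3) (exprn_ge0 _ (ltW t0)).
apply: le_trans (cnt_smooth_le R (2%:R * t ^+ 2) _ _ _ yu N0) _; first by nra.
rewrite ler_wpM2r ?expR_ge0// ler_pM ?expR_ge0 ?ler0n// ler_expR.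
have h : t ^+ 3 - 1 <= ln (Num.truncn (expR (t ^+ 3)))%:R.
  by rewrite -ler_expR lnK// posrE ltr0n.
have e : 4%:R / (2%:R * t ^+ 2) = 2%:R / t ^+ 2 by field; lra.
have i0 : 0 <= 2%:R / t ^+ 2 by rewrite divr_ge0// exprn_ge0// ltW.
have := ler_wpM2l i0 h; rewrite e.
have -> : 2%:R / t ^+ 2 * (t ^+ 3 - 1) = 2%:R * t - 2%:R / t ^+ 2 by field; lra.
have : 2%:R / t ^+ 2 <= 1 by rewrite ler_pdivrMr ?exprn_gt0//; nra.
move: (2%:R / t ^+ 2) (2%:R / t ^+ 2 * _) => b a; lra.
Qed.

(** With Y = 4t and a tail starting near exp(2t^2), the saving exponent is at least 2t - 1/t >= 2t -
    1. *)
Lemma cnt_shifted_smooth_param (R : realType) (t : R) : 2%:R <= t ->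
  (cnt (shifted_smooth_dvd (Num.truncn (expR (2%:R * t ^+ 2))) (Num.truncn (expR (4%:R * t))))
     (Num.truncn (expR (t ^+ 3))))%:R
  <= expR (t ^+ 3) * expR (1 - 2%:R * t) * rankin_const (2%:R * t ^+ 2).
Proof.
move=> t2; have t0 : 0 < t by lra.
have [y0 _ yl] := truncn_expR R (2%:R * t ^+ 2) (ltac:(nra)).
have [_ zu _] := truncn_expR R (4%:R * t) (ltac:(nra)).
have [_ Nu _] := truncn_expR R (t ^+ 3) (exprn_ge0 _ (ltW t0)).
apply: le_trans (cnt_shifted_smooth_dvd R _ _ _ y0) _; rewrite -mulrA.
apply: ler_pM => //; first by apply: sumr_ge0 => j _; rewrite invr_ge0 ler0n.
have Y8 : 8%:R <= 4%:R * t by lra.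
apply: le_trans (smooth_tail_le R (4%:R * t) _ _ _ Y8 zu y0) _.
apply: ler_pM; rewrite ?expR_ge0//; last by apply: rankin_const_mono; nra.
rewrite ler_expR.
have h : 2%:R * t ^+ 2 - 1 <= ln (Num.truncn (expR (2%:R * t ^+ 2)))%:R.
  by rewrite -ler_expR lnK// posrE ltr0n.
have e : 4%:R / (4%:R * t) = t^-1 by field; lra.
have i0 : 0 <= t^-1 by rewrite invr_ge0 ltW.
have := ler_wpM2l i0 h; rewrite e.
have -> : t^-1 * (2%:R * t ^+ 2 - 1) = 2%:R * t - t^-1 by field; lra.
have : t^-1 <= 1 by rewrite invf_le1//; lra.
move: (t^-1) (t^-1 * _) => b a; lra.
Qed.

Lemma cnt_sq_dvd_param (R : realType) (k : nat) (t : R) : 2%:R <= t -> k%:R <= expR (t ^+ 3) ->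
  (cnt (sq_dvd (Num.truncn (expR (4%:R * t)))) (Num.truncn (expR (t ^+ 3))) +
   cnt (sq_dvd (Num.truncn (expR (4%:R * t)))) (Num.truncn (expR (t ^+ 3)) + k))%N%:R
  <= expR (t ^+ 3) * expR (1 - 2%:R * t) * 3%:R.
Proof.
move=> t2 kx; have t0 : 0 < t by lra.
have [z0 _ zl] := truncn_expR R (4%:R * t) (ltac:(nra)).
have [_ Nu _] := truncn_expR R (t ^+ 3) (exprn_ge0 _ (ltW t0)).
rewrite natrD; apply: le_trans (lerD (cnt_sq_dvd R _ _ z0) (cnt_sq_dvd R _ _ z0)) _.
rewrite natrD -mulrDl mulrAC; apply: ler_pM; rewrite ?invr_ge0 ?ler0n ?addr_ge0 ?ler0n//.
  by lra.
apply: le_trans (_ : _ <= (expR (4%:R * t - 1))^-1) _.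
  by rewrite lef_pV2 ?posrE ?expR_gt0 ?ltr0n.
by rewrite -expRN ler_expR; lra.
Qed.

(** [W] exceeds x by exp(2t), and division by z saves exp(4t); the harmonic sum reaches at most
    2x. *)
Lemma cnt_common_shift_param (R : realType) (k : nat) (t : R) : 2%:R <= t -> k%:R <= expR (t ^+ 3) ->
  (cnt (fun n => common_shift_dvd (Num.truncn (expR (4%:R * t))) (Num.truncn (expR (t ^+ 3 + 2%:R * t)))
     n (n + k)) (Num.truncn (expR (t ^+ 3))))%:R
  <= expR (t ^+ 3) * expR (1 - 2%:R * t) * (2%:R * (2%:R + t ^+ 3) ^+ 2).
Proof.
move=> t2 kx; have t0 : 0 < t by lra.
have t30 := exprn_ge0 3 (ltW t0).
have [z0 _ zl] := truncn_expR R (4%:R * t) (ltac:(nra)).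
have [N0 Nu _] := truncn_expR R (t ^+ 3) t30.
have [_ Wu _] := truncn_expR R (t ^+ 3 + 2%:R * t) (ltac:(lra)).
have NW : (Num.truncn (expR (t ^+ 3)) <= Num.truncn (expR (t ^+ 3 + 2%:R * t)))%N.
  by apply: le_truncn; rewrite ler_expR; lra.
apply: le_trans (cnt_common_shift_dvd R _ _ _ k z0 NW) _.
have x1 : 1 <= expR (t ^+ 3) by rewrite -[leLHS]expR0 ler_expR.
have H : harm_sum R (Num.truncn (expR (t ^+ 3)) + k) <= 2%:R + t ^+ 3.
  apply: le_trans (harm_sum_le R _ (2%:R * expR (t ^+ 3)) _ _) _; [lra|rewrite natrD; lra|].
  rewrite lnM ?posrE ?expR_gt0// expRK.
  have : ln 2%:R <= 1 :> R.
    by rewrite -ler_expR lnK ?posrE//; have := @expR_ge1Dx R 1; lra.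
  lra.
have -> : expR (t ^+ 3) * expR (1 - 2%:R * t) * (2%:R * (2%:R + t ^+ 3) ^+ 2) =
   2%:R * expR (t ^+ 3 + 2%:R * t) * (2%:R + t ^+ 3) ^+ 2 * (expR (4%:R * t - 1))^-1.
  have -> : expR (t ^+ 3) * expR (1 - 2%:R * t) = expR (t ^+ 3 + 2%:R * t) * (expR (4%:R * t - 1))^-1.
    by rewrite -expRN -!expRD; congr expR; ring.
  by ring.
apply: ler_pM; rewrite ?invr_ge0 ?ler0n ?mulr_ge0 ?exprn_ge0 ?harm_sum_ge0//.
  apply: ler_pM; rewrite ?mulr_ge0 ?exprn_ge0 ?harm_sum_ge0 ?ler0n ?ler_pM2l//.
  by rewrite lerXn2r ?nnegrE ?harm_sum_ge0//; lra.
by rewrite lef_pV2 ?posrE ?expR_gt0 ?ltr0n.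
Qed.

(** The number V is about 2x^2/W, that is, at most 2x exp(1 - 2t), and log V is at most t^3. *)
Lemma cnt_large_pair_param (R : realType) (k : nat) (t : R) : 2%:R <= t -> k%:R <= expR (t ^+ 3) ->
  (cnt (fun n => totient n = totient (n + k) /\ large_pair (Num.truncn (expR (t ^+ 3 + 2%:R * t)))
     n (n + k)) (Num.truncn (expR (t ^+ 3))))%:R
  <= expR (t ^+ 3) * expR (1 - 2%:R * t) * (2%:R * (1 + t ^+ 3)).
Proof.
move=> t2 kx; have t0 : 0 < t by lra.
have t30 := exprn_ge0 3 (ltW t0).
have [N0 Nu _] := truncn_expR R (t ^+ 3) t30.
have [W0 _ Wl] := truncn_expR R (t ^+ 3 + 2%:R * t) (ltac:(lra)).
apply: le_trans (cnt_large_pair R _ _ k W0) _.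
set N := Num.truncn (expR (t ^+ 3)) in N0 Nu *; set W := Num.truncn _ in W0 Wl *.
set V := (_ %/ _)%N.
have x1 : 1 <= expR (t ^+ 3) by rewrite -[leLHS]expR0 ler_expR.
have VV : V%:R <= expR (t ^+ 3) * (2%:R * expR (1 - 2%:R * t)).
  apply: le_trans (ler_div_nat _ _ _) _.
  apply: le_trans (_ : _ <= expR (t ^+ 3) * (2%:R * expR (t ^+ 3)) / expR (t ^+ 3 + 2%:R * t - 1)) _.
    apply: ler_pM; rewrite ?invr_ge0 ?ler0n//; last by rewrite lef_pV2 ?posrE ?expR_gt0 ?ltr0n.
    rewrite natrM; apply: ler_pM; rewrite ?ler0n// natrD; lra.
  rewrite -expRN -!mulrA -expRD ler_pM2l ?expR_gt0// ler_pM2l// ler_expR; lra.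
have V1 : V%:R <= expR (t ^+ 3).
  apply: le_trans VV _; rewrite -[leRHS]mulr1 ler_pM2l ?expR_gt0//.
  have := expRxMexpNx_1 (2%:R * t - 1); rewrite (_ : - (2%:R * t - 1) = 1 - 2%:R * t); last by ring.
  have := @expR_ge1Dx R (2%:R * t - 1); have := expR_gt0 (1 - 2%:R * t).
  by move: (expR (1 - _)) (expR (_ - 1)) => a b; nra.
have H := harm_sum_le R V _ x1 V1; rewrite expRK in H.
apply: le_trans (ler_pM _ _ VV H) _; rewrite ?ler0n ?harm_sum_ge0//.
by rewrite mulrA -!mulrA [2%:R * (expR _ * _)]mulrCA.
Qed.

Lemma pow_le_expR (R : realType) (n : nat) : exists2 C : R, 0 < C &
  forall t, 0 <= t -> t ^+ n.+1 <= C * expR t.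
Proof.
by exists (n.+1)`!%:R => [|t]; [rewrite ltr0n fact_gt0|apply: expR_ge_pow].
Qed.

Lemma totient_pair_bound (R : realType) (l : nat) : (0 < l)%N -> exists2 C : R, 0 < C &
  forall t : R, (2 * l + 4)%:R <= t ->
  (cnt (totient_pair l) (Num.truncn (expR (t ^+ 3))))%:R <= C * (expR (t ^+ 3) / expR t) +
  (cnt (special_prime l (Num.truncn (expR (4%:R * t)))) (Num.truncn (expR (t ^+ 3))))%:R.
Proof.
move=> l0; have [C1 C10 hC1] := rankin_const_le R; have [F F0 hF] := pow_le_expR R 5.
exists (expR 1 * (2%:R * C1 + 15%:R * F)); first by rewrite mulr_gt0 ?expR_gt0//; lra.
move=> t lt; have lR : 0 <= l%:R :> R by [].
have {}lt : 2%:R * l%:R + 4%:R <= t by rewrite -natrM -natrD.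
have t2 : 2%:R <= t by lra.
have t0 : 0 < t by lra.
have tt : t <= t ^+ 2 by nra.
have ttt : t <= t ^+ 3 by rewrite exprS; nra.
have kx : (2 * l)%:R <= expR (t ^+ 3).
  by rewrite natrM; have := @expR_ge1Dx R (t ^+ 3); lra.
set y := Num.truncn (expR (2%:R * t ^+ 2)); set z := Num.truncn (expR (4%:R * t)).
set W := Num.truncn (expR (t ^+ 3 + 2%:R * t)).
have ly : (2 * l < y)%N.
  rewrite truncn_gt_nat -natr1 natrM; have := @expR_ge1Dx R (2%:R * t ^+ 2); lra.
have zy : (z <= y)%N by apply: le_truncn; rewrite ler_expR; nra.
have := cnt_totient_pair_le l y z W (Num.truncn (expR (t ^+ 3))) l0 ly zy.
rewrite -(ler_nat R) natrD => /le_trans; apply; rewrite lerD2r.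
rewrite [(_ + _ + (_ + _))%N%:R]natrD [(_ + _ + (_ + _))%N%:R]natrD [(_ + _)%N%:R in leLHS]natrD.
have B1 := cnt_smooth_param R t t2; have B2 := cnt_shifted_smooth_param R t t2.
have B3 := cnt_sq_dvd_param R (2 * l) t t2 kx.
have B4 := cnt_common_shift_param R (2 * l) t t2 kx.
have B5 := cnt_large_pair_param R (2 * l) t t2 kx.
rewrite -/y -/z -/W in B1 B2 B3 B4 B5.
rewrite [(cnt (fun _ => common_shift_dvd _ _ _ _) _ + _)%N%:R]natrD.
have D : expR (1 - 2%:R * t) = expR 1 / expR t / expR t.
  by rewrite -!expRN -!expRD; congr expR; ring.
set x := expR (t ^+ 3) in B1 B2 B3 B4 B5 *.
set A := x * expR (1 - 2%:R * t) in B1 B2 B3 B4 B5.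
apply: le_trans (_ : _ <= A * (rankin_const (2%:R * t ^+ 2) + rankin_const (2%:R * t ^+ 2) + 3%:R +
  (2%:R * (2%:R + t ^+ 3) ^+ 2) + (2%:R * (1 + t ^+ 3)))) _.
  rewrite !mulrDr; lra.
(* The polynomial has degree 2 in t^3 >= 8 and is at most 15 t^6, which O(exp t) absorbs. *)
have P : 3%:R + 2%:R * (2%:R + t ^+ 3) ^+ 2 + 2%:R * (1 + t ^+ 3) <= 15%:R * F * expR t.
  rewrite -mulrA; have := hF t (ltW t0).
  have -> : t ^+ 6 = (t ^+ 3) ^+ 2 by rewrite -exprM.
  have : 8%:R <= t ^+ 3 by rewrite exprS expr2; nra.
  by move: (t ^+ 3) (F * _) => u v u8 h; nra.
have x0 : 0 < x := expR_gt0 _.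
have e0 : 0 < expR t := expR_gt0 _.
have A0 : 0 < A by rewrite mulr_gt0 ?expR_gt0.
have -> : expR 1 * (2%:R * C1 + 15%:R * F) * (x / expR t) = A * ((2%:R * C1 + 15%:R * F) * expR t).
  by rewrite /A D; field; rewrite lt0r_neq0.
rewrite ler_pM2l// [leRHS]mulrDl -mulrA; move: P (hC1 t t2).
move: (2%:R * (2%:R + _) ^+ 2) (2%:R * (1 + _)) (rankin_const _) (C1 * _) (15%:R * F * _).
by clear; move=> a b r u v; lra.
Qed.

(** With X = log x and w near exp(X/24), the sieve error w^12 is at most about the square root of x,
    while the harmonic sum up to w still has order X. *)
Lemma special_prime_pow4_bound (R : realType) (l : nat) : (0 < l)%N -> exists2 C : R, 0 < C &
  forall t z, 6%:R <= t ->
  (cnt (special_prime l z) (Num.truncn (expR (t ^+ 3))))%:R <= C * (expR (t ^+ 3) / (t ^+ 3) ^+ 3).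
Proof.
move=> l0; have c0 := triple_const_gt0 R l; set c := triple_const R l in c0 *.
exists (48%:R + 2%:R * (24%:R / c) ^+ 3).
  by rewrite addr_gt0// mulr_gt0// exprn_gt0// divr_gt0.
move=> t z t6; have X24 : 24%:R <= t ^+ 3 by rewrite exprS expr2; nra.
move: (t ^+ 3) X24 => X X24; have X0 : 0 < X by lra.
have [w0 wu wl] := truncn_expR R (X / 24%:R) (ltac:(lra)).
have [_ Nu _] := truncn_expR R X (ltW X0).
set w := Num.truncn (expR (X / 24%:R)) in w0 wu wl; set N := Num.truncn (expR X) in Nu *.
have w1 : (1 < w)%N.
  by rewrite truncn_gt_nat; have := @expR_ge1Dx R (X / 24%:R); lra.
have H : X / 24%:R <= harm_sum R w.
  apply: le_trans (harm_sum_ge _ _); rewrite -[leLHS]expRK ler_ln ?posrE ?expR_gt0 ?ltr0n//.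
  by apply/ltW/truncnS_gt.
have w30 : (0 < w ^ 3)%N by rewrite expn_gt0 w0.
have := cnt_special_prime_le l (w ^ 3) z N l0 w30; rewrite -(ler_nat R) natrD => /le_trans; apply.
apply: le_trans (lerD (lexx _) (triple_sieve R l w N l0 w1)) _; rewrite [leRHS]mulrDl; apply: lerD.
  (* The t below the sieving limit: w^3 <= exp(X/8), and X^3 = O(exp(X/2)). *)
  apply: le_trans (_ : _ <= expR (X / 8%:R)) _.
    rewrite natrX; apply: le_trans (_ : _ <= expR (X / 24%:R) ^+ 3) _.
      by rewrite lerXn2r ?nnegrE ?expR_ge0.
    by rewrite -expRM_natr ler_expR; lra.
  rewrite mulrA ler_pdivlMr ?exprn_gt0//.
  have h : (X / 2%:R) ^+ 3 <= 6%:R * expR (X / 2%:R).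
    by apply: (@expR_ge_pow R 2); lra.
  have -> : X ^+ 3 = 8%:R * (X / 2%:R) ^+ 3 by field.
  apply: le_trans (_ : _ <= expR (X / 8%:R) * (8%:R * (6%:R * expR (X / 2%:R)))) _.
    by rewrite ler_pM2l ?expR_gt0// ler_pM2l.
  have -> : expR (X / 8%:R) * (8%:R * (6%:R * expR (X / 2%:R))) = 48%:R * expR (X / 8%:R + X / 2%:R).
    by rewrite expRD; ring.
  by rewrite ler_pM2l// ler_expR; lra.
have w12 : w%:R ^+ 12 <= expR X.
  apply: le_trans (_ : _ <= expR (X / 24%:R) ^+ 12) _; first by rewrite lerXn2r ?nnegrE ?expR_ge0.
  by rewrite -expRM_natr ler_expR; lra.
have h0 : 0 < harm_sum R w by apply: lt_le_trans H; rewrite divr_gt0.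
apply: le_trans (_ : _ <= (2%:R * expR X) / (c * (X / 24%:R)) ^+ 3) _.
  apply: ler_pM; rewrite ?invr_ge0 ?addr_ge0 ?exprn_ge0 ?mulr_ge0 ?ler0n ?(ltW c0) ?(ltW h0)//.
    by lra.
  rewrite lef_pV2 ?posrE ?exprn_gt0 ?mulr_gt0 ?divr_gt0//.
  by rewrite lerXn2r ?nnegrE ?mulr_ge0 ?(ltW c0) ?(ltW h0) ?divr_ge0 ?(ltW X0)// ler_pM2l.
rewrite le_eqVlt; apply/orP; left; apply/eqP; field.
by rewrite !lt0r_neq0.
Qed.

(** All three primes exceed z >= 3, so none of them can be a multiple of 3. *)
Lemma special_prime_empty (l z N : nat) : (0 < l)%N -> ~ pow4_pred l -> (3 <= z)%N ->
  cnt (special_prime l z) N = 0%N.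
Proof.
move=> l0 np z3; apply/eqP; rewrite -leqn0.
suff no n : ~ special_prime l z n.
  by apply: (@cnt_inj nat id [::]) => [m n _ _ /no|n _ /no].
move=> [j [t [lE z1 z2 /and3P[p1 p2 p3] _]]].
have jo := not_pow4_odd_exponent l j l0 lE np.
have big q : prime q -> (3 < q)%N -> (3 %| q)%N -> False.
  by move=> qp q3; rewrite dvdn_prime2// => /eqP q3'; rewrite -q3' in q3.
case/or3P: (three_dvd_of_odd_exponent l j t lE jo); apply: big => //; lia.
Qed.

Theorem theorem3p1 (R : realType) (l : nat) (hl : (1 <= l)%N) :
  (fun x : R => (totient_count l x)%:R) ≪
  (fun x : R => if `[< pow4_pred l >] then x / (ln x) ^+ 3
                else x / expR ((ln x) `^ (3%:R^-1))).
Proof.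
have [C1 C10 h1] := totient_pair_bound R l hl.
have [C2 C20 h2] := special_prime_pow4_bound R l hl.
have [F F0 hF] := pow_le_expR R 8.
exists (C1 * F + C2 + C1); first by rewrite !addr_gt0// mulr_gt0.
near=> x.
(* This threshold makes t at least 2l + 4, hence at least 6. *)
have xl : expR ((2 * l + 4)%:R ^+ 3) <= x by near: x; apply: nbhs_pinfty_ge; rewrite num_real.
have x0 : 0 < x by apply: lt_le_trans xl; apply: expR_gt0.
rewrite normr_nat; set t := ln x `^ 3%:R^-1.
have lnx : (2 * l + 4)%:R ^+ 3 <= ln x by rewrite -ler_expR lnK.
have lnx0 : 0 <= ln x by apply: le_trans lnx; rewrite exprn_ge0.
have t3 : t ^+ 3 = ln x.
  by rewrite -powR_mulrn ?powR_ge0// -powRrM mulVf// powRr1.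
have t0 : 0 <= t by apply: powR_ge0.
have tl : (2 * l + 4)%:R <= t.
  by rewrite -(@ler_pXn2r _ 3) ?nnegrE// t3.
have xE : x = expR (t ^+ 3) by rewrite t3 lnK.
have t6 : 6%:R <= t by apply: le_trans tl; rewrite ler_nat; lia.
have T : (totient_count l x)%:R <= C1 * (x / expR t) +
  (cnt (special_prime l (Num.truncn (expR (4%:R * t)))) (Num.truncn x))%:R.
  by apply: le_trans (_ : _ <= (cnt (totient_pair l) (Num.truncn x))%:R) _;
     [rewrite ler_nat totient_count_le|rewrite xE h1].
apply: le_trans T _; have t1 : 0 < t by lra.
have q0 : 0 <= x / expR t by rewrite divr_ge0 ?expR_ge0 ?(ltW x0).
case: asboolP => p4.
  have S := h2 t (Num.truncn (expR (4%:R * t))) t6; rewrite -xE t3 in S.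
  (* Here (log x)^3 = t^9, which is at most F exp t. *)
  have E : x / expR t <= F * (x / ln x ^+ 3).
    rewrite mulrCA ler_pM2l// -t3 -exprM.
    rewrite ler_pdivlMr ?exprn_gt0// mulrC ler_pdivrMr ?expR_gt0//.
    exact: hF.
  have q1 : 0 <= x / ln x ^+ 3 by rewrite divr_ge0 ?exprn_ge0 ?(ltW x0).
  apply: le_trans (lerD (ler_wpM2l (ltW C10) E) S) _.
  by rewrite [C1 * (F * _)]mulrA -[leLHS]mulrDl ler_wpM2r// lerDl ltW.
rewrite special_prime_empty//; last first.
  rewrite truncn_ge_nat ?expR_ge0//; have := @expR_ge1Dx R (4%:R * t); lra.
by rewrite addr0 mulrDl lerDr mulr_ge0// addr_ge0 ?mulr_ge0 ?(ltW C10) ?(ltW C20) ?(ltW F0).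
Unshelve. all: by end_near.
Qed.
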